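(* Let $N$ be a positive integer, let $l$ be a nonnegative integer, and let $Y=(y_1,\dots,y_N)$ be given by $y_1=1$ and $y_i=i+l$ for $i>1$. Let $x\in\mathbb{Z}$ and $t\ge 0$. Consider the TASEP with second class particles started from the state $(Y,21\cdots1)$, and let $E_t$ be the event that at time $t$ the species word is $21\cdots1$ and the leftmost particle is at $x$, i.e. $E_t=\{(X,21\cdots1;t)\colon x_1=x\}$. Let $C$ be a counterclockwise circle centered at the origin with radius less than $1$. Then $$\mathbb{P}_{(Y,21\cdots1)}(E_t)=\frac{(-1)^{N(N-1)/2}}{N!}\Big(\frac{1}{2\pi i}\Big)^N\oint_C\cdots\oint_C h_l(\xi_1,\dots,\xi_N)\prod_{1\le i<j\le N}(\xi_j-\xi_i)^2\ \prod_{i=1}^N\frac{1}{(\xi_i-1)^{N-1}}\ \prod_{i=1}^N\Big(\xi_i^{x-N-l-1}e^{\varepsilon(\xi_i)t}\Big)\,d\xi_1\cdots d\xi_N,$$ where $\varepsilon(\xi_i)=1/\xi_i-1$.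
   Context: The TASEP with second class particles (with $N$ particles) is the continuous-time Markov process defined as follows. Each site of $\mathbb{Z}$ is occupied by at most one particle and each particle belongs to species $1$ or species $2$. Particles of species $1$ are called second class particles and particles of species $2$ are called first class particles. Each particle, located at $z$ say, tries to jump to $z+1$ after an exponentially distributed waiting time of rate $1$ (independently for all particles). If $z+1$ is empty, the particle jumps to $z+1$. If $z+1$ is occupied by a particle of the same species, the jump is forbidden and the waiting time is reset. If the particle at $z$ is of species $2$ and $z+1$ is occupied by a particle of species $1$, the two particles interchange positions. If the particle at $z$ is of species $1$ and $z+1$ is occupied by a particle of species $2$, the jump is forbidden and the waiting time is reset. A state is a pair $(X,\pi)$ with $X=(x_1,\dots,x_N)\in\mathbb{Z}^N$, $x_1<\cdots<x_N$, and $\pi=\pi_1\cdots\pi_N$ a word in $\{1,2\}$; it means that the $i$-th particle from the left is at $x_i$ and is of species $\pi_i$. The notation $(X,\pi;t)$ means the state at time $t$ is $(X,\pi)$. $\mathbb{P}_{(Y,\nu)}$ is the probability measure of the process with initial state $(Y,\nu)$. $h_l(\xi_1,\dots,\xi_N)=\sum_{1\le i_1\le\cdots\le i_l\le N}\xi_{i_1}\xi_{i_2}\cdots\xi_{i_l}$ is the $l$-th complete symmetric polynomial, with $h_0=1$. *)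

(* Defs.v *)
From HB Require Import structures.
From mathcomp Require Import all_boot all_order all_algebra perm.
From mathcomp Require Import all_classical all_reals all_analysis.
From mathcomp Require Import complex.

Set Implicit Arguments.
Unset Strict Implicit.
Unset Printing Implicit Defensive.

Import Order.TTheory GRing.Theory Num.Theory.
Import numFieldNormedType.Exports.

Local Open Scope classical_set_scope.
Local Open Scope ring_scope.

(* Species are booleans: [sp2] marks a first class particle and [sp1] a second
   class particle.  Particles are numbered from 0, left to right. *)
Definition sp1 : bool := false.
Definition sp2 : bool := true.

Definition positions (N : nat) := {ffun 'I_N -> int}.
Definition word (N : nat) := {ffun 'I_N -> bool}.

Definition increasing (N : nat) (X : positions N) : bool :=
  [forall i : 'I_N, forall j : 'I_N, (i < j)%N ==> (X i < X j)].

Definition state (N : nat) :=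
  {s : positions N * word N | increasing s.1}.

Definition pos (N : nat) (s : state N) : positions N := (val s).1.
Definition spec (N : nat) (s : state N) : word N := (val s).2.

(* Effect of a jump attempt by particle i; the j picked, if any, is the only
   particle at the target site since X is increasing. *)
Definition raw_jump (N : nat) (s : positions N * word N) (i : 'I_N) :
    positions N * word N :=
  let: (X, w) := s in
  if [pick j | X j == X i + 1] is Some j then
    if (w i == sp2) && (w j == sp1) then (X, [ffun k => w (tperm i j k)])
    else (X, w)
  else ([ffun k => if k == i then X k + 1 else X k], w).

Lemma raw_jump_increasing (N : nat) (s : positions N * word N) (i : 'I_N) :
  increasing s.1 -> increasing (raw_jump s i).1.
Proof.
case: s => X w /= incX; rewrite /raw_jump.
case: pickP => [j _|empty]; first by case: ifP.
apply/forallP => a; apply/forallP => b; apply/implyP => ltab /=.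
have ltX : X a < X b by move: incX => /forallP/(_ a)/forallP/(_ b)/implyP; apply.
rewrite !ffunE; case: (eqVneq a i) => [ai|_]; case: (eqVneq b i) => [bi|_] //.
- by move: ltab; rewrite ai bi ltnn.
- by rewrite lt_def ai empty lezD1 -ai.
- by rewrite (lt_trans ltX)// ltzD1.
Qed.

Definition jump (N : nat) (s : state N) (i : 'I_N) : state N :=
  Sub (raw_jump (val s) i) (raw_jump_increasing i (valP s)).

(* Each of the N particles attempts a jump at rate 1, independently; the
   subtracted term puts minus the total exit rate on the diagonal and cancels
   the attempts that leave the state unchanged. *)
Definition tasep_rate (R : realType) (N : nat) (s s' : state N) : R :=
  \sum_(i < N) ((jump s i == s')%:R - (s == s')%:R).

(* Standard transition function on a countable state space with Q-matrix q:
   stochastic, satisfying Chapman-Kolmogorov, with derivative q at 0+. *)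
Definition transition_function (R : realType) (S : choiceType)
    (q : S -> S -> R) (p : R -> S -> S -> R) : Prop :=
  [/\ forall (t : R) x y, 0 <= t -> 0 <= p t x y,
      forall (t : R) x, 0 <= t -> (\esum_(y in [set: S]) (p t x y)%:E = 1)%E,
      forall x y, p 0 x y = (x == y)%:R,
      forall (s t : R) x z, 0 <= s -> 0 <= t ->
        (p (s + t) x z)%:E = (\esum_(y in [set: S]) (p s x y * p t y z)%:E)%E
    & forall x y, (p h x y - p 0 x y) / h @[h --> 0^'+] --> q x y].

(* [Z] is a time-homogeneous continuous-time Markov process with jump rates q
   started from x0.  In the Markov property, [past] is a finite list of
   (time, state) pairs; it is stated in product form, so that no conditioning
   on null events occurs. *)
Definition markov_process (R : realType) (S : choiceType) (q : S -> S -> R)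
    (d : measure_display) (Omega : measurableType d) (P : probability Omega R)
    (Z : R -> Omega -> S) (x0 : S) : Prop :=
  [/\ forall (t : R) x, 0 <= t -> measurable [set om | Z t om = x],
      P [set om | Z 0 om = x0] = 1%E
    & exists2 p : R -> S -> S -> R, transition_function q p &
      forall (past : seq (R * S)) (s t : R) (x y : S),
        0 <= s -> 0 <= t -> (forall u : R * S, u \in past -> 0 <= u.1 <= s) ->
        let H := [set om | Z s om = x /\
                           forall u : R * S, u \in past -> Z u.1 om = u.2] in
        P (H `&` [set om | Z (s + t) om = y]) = (P H * (p t x y)%:E)%E].

Definition is_tasep (R : realType) (N : nat)
    (d : measure_display) (Omega : measurableType d) (P : probability Omega R)
    (Z : R -> Omega -> state N) (s0 : state N) : Prop :=
  markov_process (@tasep_rate R N) P Z s0.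

(* The word 21...1. *)
Definition word21 (N : nat) : word N :=
  [ffun i : 'I_N => if val i == 0%N then sp2 else sp1].

(* y_1 = 1 and y_i = i + l for i > 1, with the index shifted to start at 0. *)
Definition Y0 (N l : nat) : positions N :=
  [ffun i : 'I_N => if val i == 0%N then 1%:Z else (i.+1 + l)%N%:Z].

Lemma Y0_increasing (N l : nat) : increasing (Y0 N l).
Proof.
apply/forallP => i; apply/forallP => j; apply/implyP => ltij; rewrite !ffunE.
case: (eqVneq (i : nat) 0%N) => i0; case: (eqVneq (j : nat) 0%N) => j0.
- by rewrite i0 j0 in ltij.
- by rewrite ltz_nat addSn ltnS addn_gt0 lt0n j0.
- by rewrite j0 in ltij.
- by rewrite ltz_nat ltn_add2r ltnS.
Qed.

Definition init_state (N l : nat) : state N :=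
  Sub (Y0 N l, word21 N) (Y0_increasing N l).

Definition cexp (R : realType) (z : R[i]) : R[i] :=
  let: Complex a b := z in Complex (expR a * cos b) (expR a * sin b).

Definition Cintegral (R : realType) (a b : R) (f : R -> R[i]) : R[i] :=
  Complex (\int[@lebesgue_measure R]_(th in `[a, b]) complex.Re (f th))
          (\int[@lebesgue_measure R]_(th in `[a, b]) complex.Im (f th)).

(* Integral over the circle z = r e^(i th), 0 <= th <= 2 pi,
   with dz = i r e^(i th) dth. *)
Definition oint (R : realType) (r : R) (f : R[i] -> R[i]) : R[i] :=
  Cintegral 0 (2 * pi) (fun th =>
    let z := (r%:C * cexp (Complex 0 th))%C in f z * ('i%C * z)).

Fixpoint iter_oint (R : realType) (r : R) (n : nat) :
    (n.-tuple R[i] -> R[i]) -> R[i] :=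
  match n with
  | 0%N => fun F => F [tuple]
  | m.+1 => fun F =>
      oint r (fun z => iter_oint r (fun v : m.-tuple R[i] =>
        F [tuple of z :: v]))
  end.

Definition complete_sym (A : comNzRingType) (N l : nat) (xi : N.-tuple A) : A :=
  \sum_(s : l.-tuple 'I_N | sorted leq [seq val i | i <- s])
    \prod_(i <- s) tnth xi i.

Definition epsilon (R : realType) (z : R[i]) : R[i] := z^-1 - 1.

Arguments iter_oint {R} r n F.

(* Main.v *)
(* On the event that the species word is still 21...1, the leftmost particle has
   been moving freely and is killed when it tries to overtake its neighbour,
   while the other particles form an ordinary TASEP.  As a function of the
   initial positions y_0 < y_1 < ... < y_(N-1) the probability of the event
   therefore solves the backward equation
     du/dt (y) = sum_j (u (y + e_j) - u y),
   with u = 0 on y_0 = y_1, and u (y + e_j) = u y when y_(j+1) = y_j + 1, j >= 1.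
   A determinant of contour integrals
     (1/2 pi i) oint z^(x-1-y_j) (1-z)^(max(j-1,0)-k) e^(eps(z) t) dz
   solves the same problem: the boundary conditions are column operations, and at
   t = 0 the matrix is triangular with determinant [y_0 = x].  Solutions growing
   at most exponentially in the positions are unique, because the jump rates are
   bounded.  For the special initial positions the two determinants in the
   integrand are a Vandermonde determinant in 1/(1-xi) and h_l times a
   Vandermonde determinant, so that the Andreief identity gives the formula. *)
Require Import Defs.
From mathcomp Require Import all_boot all_order all_algebra perm.
From mathcomp Require Import all_classical all_reals all_analysis.
From mathcomp Require Import complex.
From mathcomp Require Import ring lra zify.

Set Implicit Arguments.
Unset Strict Implicit.
Unset Printing Implicit Defensive.

Import Order.TTheory GRing.Theory Num.Theory.
Import numFieldNormedType.Exports.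

Local Open Scope classical_set_scope.
Local Open Scope ring_scope.

(** * Uniqueness for the backward equation *)

(** The event is a union over infinitely many final configurations, so the final condition is kept
    fixed and the initial state is varied; hence the backward equation. A transition function is
    given only by its entrywise derivative at 0+, so this equation has to be derived. Each state has
    at most N successors, which gives the uniformity in time that the derivation requires. The
    determinant is not known in advance to be bounded: its row j grows like r^(-y_j). Uniqueness is
    therefore proved in a weighted class where one jump costs at most a factor r^-1. The exclusion
    condition rests on z^n (1-z)^(e+1) = z^n (1-z)^e - z^(n+1) (1-z)^e. At t = 0 the same identity,
    with decay in n when e < 0, reduces the values needed to the integrals of z^n. Finally, h_l
    arises as the constant term of a polynomial in b = 1/xi, of degree below N, that takes the value
    b^-l at the N nodes. *)

Section calculus.
Variable R : realType.

Lemma is_derive_eps (f : R -> R) (t l : R) :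
  (forall e, 0 < e -> exists2 dl, 0 < dl &
     forall h, 0 < `|h| < dl -> `|f (h + t) - f t - h * l| <= e * `|h|) ->
  is_derive t 1 f l.
Proof.
move=> H.
have cv : (h^-1 *: (f (h *: 1 + t) - f t)) @[h --> 0^'] --> l.
  apply/cvgrPdist_le => e e0; have [dl dl0 Hd] := H _ e0.
  near=> h.
  have h0 : h != 0 by near: h; exact: nbhs_dnbhs_neq.
  have hd : `|h| < dl by near: h; exact: dnbhs0_lt.
  have := Hd h; rewrite normr_gt0 h0 hd => /(_ isT) Hh.
  rewrite -(ler_pM2r (_ : 0 < `|h|)) ?normr_gt0// -normrM.
  rewrite [X in `|X|](_ : _ = - (f (h + t) - f t - h * l)) ?normrN//.
  by rewrite /GRing.scale/= mulr1; field.
apply: DeriveDef; first by apply/cvg_ex; exists l.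
exact/cvg_lim.
Unshelve. all: by end_near. Qed.

(** Both G - w and G + w are nondecreasing. At 0 only right continuity of [w] is asked, because the
    backward equation is established for positive times. *)
Lemma norm_le_of_derive (T : R) (w G dw dG : R -> R) :
  (forall t : R, 0 < t -> is_derive t 1 w (dw t)) ->
  (forall t : R, is_derive t 1 G (dG t)) ->
  w 0 = 0 -> G 0 = 0 -> w t @[t --> 0^'+] --> w 0 ->
  (forall t, 0 <= t <= T -> `|dw t| <= dG t) ->
  forall t, 0 <= t <= T -> `|w t| <= G t.
Proof.
move=> Dw DG w0 G0 cw0 le_d t /andP[t0 tT].
have [->|/eqP tn0] := eqVneq t 0; first by rewrite w0 G0 normr0.
have {}t0 : 0 < t by rewrite lt_neqAle eq_sym t0 andbT; apply/eqP.
have cG x : {for x, continuous G}.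
  by apply: differentiable_continuous; apply/derivable1_diffP; have [] := DG x.
have cw x : 0 < x -> {for x, continuous w}.
  move=> x0; apply: differentiable_continuous; apply/derivable1_diffP.
  by have [] := Dw x x0.
have key (s : bool) : 0 <= G t - (-1) ^+ s * w t.
  pose g x := G x - (-1) ^+ s * w x.
  have Dg (x : R) : 0 < x -> is_derive x 1 g (dG x - (-1) ^+ s * dw x).
    move=> x0; have := Dw x x0; have := DG x => ? ?; apply: is_derive_eq.
    by rewrite ?[_ *: 0]scaler0 /GRing.scale/= ?mulr0 ?addr0//=.
  have /(_ 0 t) : {in `[0, t]%R &, {homo g : x y / x <= y >-> x <= y}}.
    apply: ger0_derive1_le_cc.
    - by move=> x; rewrite in_itv/= => /andP[x0 _]; have [] := Dg x x0.
    - move=> x; rewrite in_itv/= => /andP[x0 xt].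
      have ? := Dg x x0; rewrite derive1E derive_val subr_ge0.
      apply: le_trans (le_d x _); last first.
        by rewrite (ltW x0) (le_trans (ltW xt)).
      clear; case: s; rewrite ?expr1 ?expr0 ?mulN1r ?mul1r ?ler_norm//.
      by rewrite -normrN ler_norm.
    apply/continuous_within_itvP => //; split.
    - move=> x; rewrite in_itv/= => /andP[x0 _].
      by apply: differentiable_continuous; apply/derivable1_diffP; have [] := Dg x x0.
    - apply: cvgB; first exact: cvg_at_right_filter (cG 0).
      by apply: cvgMr.
    - apply: cvg_at_left_filter.
      by apply: differentiable_continuous; apply/derivable1_diffP; have [] := Dg t t0.
  rewrite !in_itv/= lexx (ltW t0) lexx /g w0 G0 mulr0 subr0; exact.
rewrite ler_norml; have := key true; have := key false.
by rewrite expr0 expr1 mul1r mulN1r opprK => ? ?; apply/andP; split; lra.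
Qed.

(* Iterating the integral inequality n times bounds the solution by the n-th
   term of the series of C W exp(K t). *)
Lemma backward_unique (S : Type) (n : nat) (J : S -> 'I_n -> S) (W : S -> R)
    (a C T : R) (w : R -> S -> R) :
  (forall s, 0 <= W s) -> 0 <= C -> 0 <= a ->
  (forall s i, W (J s i) <= a * W s) ->
  (forall s, w 0 s = 0) ->
  (forall s, w t s @[t --> 0^'+] --> w 0 s) ->
  (forall (t : R) s, 0 < t ->
     is_derive t 1 (w ^~ s) (\sum_(i < n) (w t (J s i) - w t s))) ->
  (forall t s, 0 <= t <= T -> `|w t s| <= C * W s) ->
  forall t s, 0 <= t <= T -> w t s = 0.
Proof.
move=> W0 C0 a0 WJ w0 cw Dw bw t s tT.
(* Each of the n differences is at most a + 1 times the current bound, so one integration gains the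
   factor K t / (m + 1). *)
pose K : R := n%:R * (a + 1).
have K0 : 0 <= K by rewrite mulr_ge0// addr_ge0.
have bnd m : forall t s, 0 <= t <= T -> `|w t s| <= C * W s * exp_coeff (K * t) m.
  elim: m => [|m IH] {}t {}s {}tT.
    by rewrite /exp_coeff /= expr0 fact0 invr1 !mulr1; exact: bw.
  have [c cE] : exists c : R, c = C * W s * K ^+ m.+1 / (m.+1)`!%:R by eexists.
  rewrite [leRHS](_ : _ = c * t ^+ m.+1); last first.
    by rewrite cE /exp_coeff/= exprMn; ring.
  have DG (u : R) : is_derive u 1 (fun t : R => c * t ^+ m.+1) (c * (m.+1%:R * u ^+ m)).
    rewrite (_ : (fun t => _) = c \*: (id : R -> R) ^+ m.+1); last first.
      by apply/funext => y; rewrite /= exprfctE.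
    have := is_deriveZ c (is_deriveX m.+1 (is_derive_id u (1 : R))).
    by rewrite /GRing.scale/= mulr1.
  have G0 : c * (0 : R) ^+ m.+1 = 0 by rewrite expr0n mulr0.
  apply: (norm_le_of_derive (fun t => Dw t s) DG (w0 s) G0 (cw s) _ tT).
  move=> u uT; apply: (le_trans (ler_norm_sum _ _ _)).
  apply: (@le_trans _ _ (\sum_(i < n) (a + 1) * (C * W s * exp_coeff (K * u) m))).
    apply: ler_sum => i _; apply: (le_trans (ler_normB _ _)).
    rewrite mulrDl mul1r lerD// ?IH//.
    apply: (le_trans (IH _ _ uT)).
    have e0 : 0 <= exp_coeff (K * u) m.
      by apply: exp_coeff_ge0; rewrite mulr_ge0//; case/andP: uT.
    rewrite mulrA (mulrCA a); apply: ler_wpM2r => //; exact: ler_wpM2l.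
  rewrite sumr_const card_ord -[leLHS]mulr_natl !mulrA -/K cE /exp_coeff/= exprMn exprS.
  rewrite factS natrM invfM le_eqVlt; apply/orP; left; apply/eqP.
  have f0 : m`!%:R != 0 :> R by rewrite pnatr_eq0 -lt0n fact_gt0.
  have n0 : m.+1%:R != 0 :> R by rewrite pnatr_eq0.
  move: f0 n0; move: (m`!%:R) (m.+1%:R) => f k f0 n0.
  by field; rewrite ?f0 ?n0.
apply/eqP; rewrite -normr_eq0 eq_le normr_ge0 andbT.
have cv : C * W s * exp_coeff (K * t) m @[m --> \oo] --> C * W s * 0.
  by apply: cvgMr; apply: cvg_series_cvg_0; exact: is_cvg_series_exp_coeff.
rewrite mulr0 in cv.
by apply: (cvgr_to_ge cv); near=> m; exact: bnd.
Unshelve. all: by end_near. Qed.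

End calculus.

(** * The backward equation for transition functions *)

Section esum_extra.
Variable R : realType.

Lemma exchange_esum (I J : choiceType) (A : set I) (B : set J)
    (a : I -> J -> \bar R) : (forall i j, 0 <= a i j)%E ->
  (\esum_(i in A) \esum_(j in B) a i j = \esum_(j in B) \esum_(i in A) a i j)%E.
Proof.
move=> a0.
rewrite (@esum_esum _ _ _ A (fun=> B) a)//.
rewrite (@esum_esum _ _ _ B (fun=> A) (fun j i => a i j))//.
rewrite (@reindex_esum R _ _ (B `*`` (fun=> A)) (A `*`` (fun=> B))
  (fun k => (k.2, k.1)))//.
split.
- by move=> [j i] [].
- by move=> [j i] [j' i'] _ _ [-> ->].
- by move=> [i j] [Ai Bj]; exists (j, i).
Qed.

(** The inequality for c^-1, applied to the family c a, is the reverse inequality for c. *)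
Lemma esumZl (I : choiceType) (A : set I) (c : R) (a : I -> \bar R) :
  0 <= c -> (forall i, 0 <= a i)%E ->
  (\esum_(i in A) (c%:E * a i) = c%:E * \esum_(i in A) a i)%E.
Proof.
move=> c0 a0.
have le_Zl (b : I -> \bar R) (k : R) : 0 <= k -> (forall i, 0 <= b i)%E ->
    (\esum_(i in A) (k%:E * b i) <= k%:E * \esum_(i in A) b i)%E.
  move=> k0 b0; apply: ge_ereal_sup => _ [X [finX XA] <-].
  rewrite -ge0_mule_fsumr//; apply: lee_wpmul2l; rewrite ?lee_fin//.
  by apply: ereal_sup_ubound; exists X.
apply/eqP; rewrite eq_le le_Zl//=.
have [->|cn0] := eqVneq c 0.
  by rewrite mul0e; apply: esum_ge0 => i _; rewrite mul0e.
have cgt0 : 0 < c by rewrite lt_neqAle eq_sym cn0.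
have ci0 : 0 <= c^-1 by rewrite invr_ge0.
have ca0 i : (0 <= c%:E * a i)%E by rewrite mule_ge0 ?lee_fin.
have /= := le_Zl (fun i => c%:E * a i)%E c^-1 ci0 ca0.
under eq_esum do rewrite muleA -EFinM mulVf// mul1e.
move=> /(@lee_wpmul2l _ c%:E); rewrite lee_fin => /(_ c0).
by rewrite muleA -EFinM divff// mul1e.
Qed.

End esum_extra.

Lemma near_all (T : eqType) (K : Type) (F : set_system K) (FF : Filter F)
    (P : K -> T -> Prop) (s : seq T) :
  (forall y, \forall h \near F, P h y) ->
  \forall h \near F, forall y, y \in s -> P h y.
Proof.
move=> FP; elim: s => [|x s IH]; first by near=> h.
near=> h => y; rewrite inE => /orP[/eqP->|]; first by near: h; exact: FP.
by move: y; near: h.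
Unshelve. all: by end_near. Qed.

Section semigroup.
Variables (R : realType) (S : choiceType) (N : nat) (J : S -> 'I_N -> S).
Let q (x y : S) : R := \sum_(i < N) ((J x i == y)%:R - (x == y)%:R).
Variable p : R -> S -> S -> R.
Hypothesis tfp : transition_function q p.

Let p_ge0 (t : R) x y : 0 <= t -> 0 <= p t x y.
Proof. by move=> t0; case: tfp => /(_ t x y t0). Qed.

(** The probability of lying in E at the fixed time t, not of having visited E before; for t >= 0
    the sum is at most 1, so [fine] loses nothing. *)
Definition hitting (E : set S) (t : R) (x : S) : R :=
  fine (\esum_(y in E) (p t x y)%:E).

Variable E : set S.
Local Notation v := (hitting E).

Let esum_le1 t x : 0 <= t -> (\esum_(y in E) (p t x y)%:E <= 1)%E.
Proof.
move=> t0; case: tfp => _ /(_ t x t0) <- _ _ _.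
rewrite (esumID E [set: S]); last by move=> y _; rewrite lee_fin p_ge0.
by rewrite setTI leeDl//; apply: esum_ge0 => y _; rewrite lee_fin p_ge0.
Qed.

Lemma esum_hitting t x : 0 <= t -> (\esum_(y in E) (p t x y)%:E = (v t x)%:E)%E.
Proof.
move=> t0; rewrite fineK// ge0_fin_numE.
  by apply: (le_lt_trans (esum_le1 x t0)); exact: ltry.
by apply: esum_ge0 => y _; rewrite lee_fin p_ge0.
Qed.

Lemma hitting_ge0 t x : 0 <= t -> 0 <= v t x.
Proof.
move=> t0; rewrite -lee_fin -esum_hitting//.
by apply: esum_ge0 => y _; rewrite lee_fin p_ge0.
Qed.

Lemma hitting_le1 t x : 0 <= t -> v t x <= 1.
Proof.
by move=> t0; rewrite -lee_fin -esum_hitting// esum_le1.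
Qed.

Lemma hitting_CK h t x : 0 <= h -> 0 <= t ->
  ((v (h + t) x)%:E = \esum_(y in [set: S]) (p h x y * v t y)%:E)%E.
Proof.
move=> h0 t0; rewrite -esum_hitting ?addr_ge0//.
under eq_esum => z _.
  case: tfp => _ _ _ /(_ h t x z h0 t0) -> _.
over.
rewrite exchange_esum; last by move=> z y; rewrite lee_fin mulr_ge0// p_ge0.
apply: eq_esum => y _; under eq_esum do rewrite EFinM.
rewrite esumZl ?p_ge0//; last by move=> z; rewrite lee_fin p_ge0.
by rewrite esum_hitting// EFinM.
Qed.

(** By Chapman-Kolmogorov the difference is the contribution of the intermediate states outside F.
    Since v <= 1, it is at most the mass that F misses. *)
Lemma hitting_finite_part (F : seq S) h t x : uniq F -> 0 <= h -> 0 <= t ->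
  0 <= v (h + t) x - \sum_(y <- F) p h x y * v t y
    <= 1 - \sum_(y <- F) p h x y.
Proof.
move=> uF h0 t0.
pose A := [set` F].
have split_esum (g : S -> R) : (forall y, 0 <= g y) ->
    (\esum_(y in [set: S]) (g y)%:E =
     (\sum_(y <- F) g y)%:E + \esum_(y in ~` A) (g y)%:E)%E.
  move=> g0; rewrite (esumID A setT)//; last by move=> y _; rewrite lee_fin.
  rewrite !setTI esum_fset; [|exact: finite_seq|by move=> y _; rewrite lee_fin].
  by rewrite -fsbig_seq// sumEFin.
have := hitting_CK x h0 t0.
rewrite split_esum; last by move=> y; rewrite mulr_ge0 ?p_ge0 ?hitting_ge0.
have : (\esum_(y in [set: S]) (p h x y)%:E = 1)%E by case: tfp => _ ->.
rewrite split_esum; last by move=> y; exact: p_ge0.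
have : (0 <= \esum_(y in ~` A) (p h x y * v t y)%:E <=
          \esum_(y in ~` A) (p h x y)%:E)%E.
  rewrite esum_ge0/=; last by move=> y _; rewrite lee_fin mulr_ge0 ?p_ge0 ?hitting_ge0.
  apply: le_esum => y _; rewrite lee_fin ler_piMr ?p_ge0//; exact: hitting_le1.
move: (\esum_(y in ~` A) _)%E (\esum_(y in ~` A) _)%E => [a| |] [b| |]//=.
rewrite !lee_fin -!EFinD => /andP[a0 ab] [bE] [aE].
by apply/andP; split; lra.
Qed.

(* Since the rows of q vanish outside a finite set and sum to 0, the rows of
   (p h - id)/h converge to those of q in l^1; hence uniformity in t. *)
Lemma hitting_increment (e : R) x : 0 < e ->
  \forall h \near (0 : R)^'+, forall t, 0 <= t ->
    `|v (h + t) x - v t x - h * \sum_(i < N) (v t (J x i) - v t x)| <= e * h.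
Proof.
move=> e0.
pose F := undup (x :: [seq J x i | i <- enum 'I_N]).
have uF : uniq F by exact: undup_uniq.
have xF : x \in F by rewrite mem_undup mem_head.
have JF i : J x i \in F.
  by rewrite mem_undup inE; apply/orP; right; apply/mapP; exists i; rewrite ?mem_enum.
(* The error is at most twice |F| d h, once from the states in F and once from the mass outside; the
   extra 1 keeps the denominator positive. *)
pose d : R := e / (size F).*2.+1%:R.
have d0 : 0 < d by rewrite divr_gt0.
have p0 y : p 0 x y = (x == y)%:R by case: tfp.
have sum_delta (g : S -> R) z : z \in F -> \sum_(y <- F) (z == y)%:R * g y = g z.
  move=> zF; rewrite (bigD1_seq z)//= eqxx mul1r big1 ?addr0// => y yz.
  by rewrite eq_sym (negbTE yz) mul0r.
have sum_q (g : S -> R) : \sum_(y <- F) q x y * g y = \sum_(i < N) (g (J x i) - g x).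
  rewrite /q; under eq_bigr do rewrite mulr_suml.
  rewrite exchange_big/=; apply: eq_bigr => i _.
  by under eq_bigr do rewrite mulrBl; rewrite sumrB !sum_delta.
have near_q : \forall h \near (0 : R)^'+, forall y, y \in F ->
    `|(p h x y - p 0 x y) / h - q x y| <= d.
  apply: near_all => y; case: tfp => _ _ _ _ /(_ x y) /cvgrPdist_le /(_ _ d0).
  by apply: filterS => h; rewrite distrC.
near=> h => t t0.
have h0 : 0 < h by near: h; exact: nbhs_right_gt.
pose r y := p h x y - (x == y)%:R - h * q x y.
have rd y : y \in F -> `|r y| <= d * h.
  move=> yF; rewrite -ler_pdivrMr// -[X in _ / X](gtr0_norm h0) -normf_div.
  rewrite [X in `|X|](_ : _ = (p h x y - p 0 x y) / h - q x y); last first.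
    by rewrite /r p0; field; rewrite gt_eqF.
  by move: y yF; near: h.
have sum_r (g : S -> R) : \sum_(y <- F) p h x y * g y =
    g x + h * (\sum_(i < N) (g (J x i) - g x)) + \sum_(y <- F) r y * g y.
  rewrite -sum_q -{1}(sum_delta g x xF) mulr_sumr -!big_split/=.
  by apply: eq_bigr => y _; rewrite /r; ring.
have bnd_r (g : S -> R) : (forall y, `|g y| <= 1) ->
    `|\sum_(y <- F) r y * g y| <= (size F)%:R * (d * h).
  move=> g1; apply: (le_trans (ler_norm_sum _ _ _)).
  rewrite -sum1_size natr_sum mulr_suml big_seq [leRHS]big_seq.
  apply: ler_sum => y yF; rewrite normrM mul1r.
  by rewrite -[leRHS]mulr1; apply: ler_pM => //; exact: rd.
have := hitting_finite_part x uF (ltW h0) t0.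
have := bnd_r (v t); have := bnd_r (fun=> 1).
rewrite normr1 => /(_ (fun=> lexx _)) b1 /(_ _) b2.
have {}b2 : `|\sum_(y <- F) r y * v t y| <= (size F)%:R * (d * h).
  by apply: b2 => y; rewrite ger0_norm ?hitting_ge0// hitting_le1.
(* The rows of q sum to 0, so g = 1 in [sum_r] identifies the mass outside F with minus the sum of
   the remainders r. *)
have -> : \sum_(y <- F) p h x y = 1 + \sum_(y <- F) r y * 1.
  transitivity (\sum_(y <- F) p h x y * 1).
    by apply: eq_bigr => y _; rewrite mulr1.
  rewrite (sum_r (fun=> 1)) [X in 1 + h * X]big1 ?mulr0 ?addr0// => i _.
  by rewrite subrr.
rewrite sum_r => /andP[].
have -> : e * h = (size F)%:R * (d * h) + (size F)%:R * (d * h) + d * h.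
  have n0 : (size F).*2.+1%:R != 0 :> R by rewrite pnatr_eq0.
  rewrite /d -mul2n -natr1 natrM; field.
  by move: n0; rewrite -mul2n -natr1 natrM.
have dh0 : 0 <= d * h by rewrite mulr_ge0 ?ltW.
move: b1 b2; rewrite !ler_norml => /andP[? ?] /andP[? ?] ? ?.
apply/andP; split; lra.
Unshelve. all: by end_near. Qed.

(** Uniformity in t is what later allows the generator at time t + h, h < 0, to be replaced by the
    generator at time t. *)
Lemma hitting_lipschitz x :
  \forall h \near (0 : R)^'+, forall t, 0 <= t ->
    `|v (h + t) x - v t x| <= (1 + N%:R) * h.
Proof.
near=> h => t t0.
have h0 : 0 < h by near: h; exact: nbhs_right_gt.
have : `|v (h + t) x - v t x - h * \sum_(i < N) (v t (J x i) - v t x)| <= 1 * h.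
  by move: t t0; near: h; apply: hitting_increment.
have : `|\sum_(i < N) (v t (J x i) - v t x)| <= N%:R.
  apply: (le_trans (ler_norm_sum _ _ _)).
  rewrite -[X in X%:R]card_ord -sum1_card natr_sum; apply: ler_sum => i _.
  rewrite ler_norml; apply/andP.
  have := hitting_ge0 x t0; have := hitting_ge0 (J x i) t0.
  by have := hitting_le1 x t0; have := hitting_le1 (J x i) t0; split; lra.
set B := (X in h * X) => BN.
have : `|h * B| <= h * N%:R by rewrite normrM gtr0_norm// ler_pM2l.
rewrite !ler_norml => /andP[? ?] /andP[? ?].
by apply/andP; split; lra.
Unshelve. all: by end_near. Qed.

Lemma hitting_cvg0 x : v t x @[t --> 0^'+] --> v 0 x.
Proof.
apply/cvgrPdist_le => e e0; near=> h.
have h0 : 0 < h by near: h; exact: nbhs_right_gt.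
have lip : forall t, 0 <= t -> `|v (h + t) x - v t x| <= (1 + N%:R) * h.
  by near: h; exact: hitting_lipschitz.
have := lip 0 (lexx 0); rewrite addr0 distrC => /le_trans; apply.
rewrite mulrC -ler_pdivlMr ?ltr_wpDr//; near: h.
by apply: nbhs_right_le; rewrite divr_gt0// ltr_wpDr.
Unshelve. all: by end_near. Qed.

(** The right derivative is [hitting_increment] at t. For h < 0 the increment is taken from s = t +
    h, which yields the generator at time s; the Lipschitz bound at x and at its successors moves it
    back to t. *)
Lemma hitting_backward (t : R) x : 0 < t ->
  is_derive t 1 (v ^~ x) (\sum_(i < N) (v t (J x i) - v t x)).
Proof.
move=> t0; apply: is_derive_eps => e e0.
pose F := x :: [seq J x i | i <- enum 'I_N].
have e20 : 0 < e / 2 by rewrite divr_gt0.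
have near1 : \forall h \near (0 : R)^'+,
   [/\ forall y, y \in F -> forall t, 0 <= t ->
         `|v (h + t) y - v t y| <= (1 + N%:R) * h,
       forall t, 0 <= t ->
    `|v (h + t) x - v t x - h * \sum_(i < N) (v t (J x i) - v t x)| <= (e / 2) * h,
       h < t & 2 * N%:R * ((1 + N%:R) * h) <= e / 2].
  near=> h; split.
  - by near: h; apply: near_all => y; exact: hitting_lipschitz.
  - by near: h; apply: hitting_increment.
  - by near: h; apply: nbhs_right_lt.
  - have c0 : 0 < 2 * N%:R * (1 + N%:R) + 1 :> R.
      by rewrite ltr_wpDl// mulr_ge0 ?mulr_ge0 ?addr_ge0.
    have h0 : 0 < h by near: h; exact: nbhs_right_gt.
    apply: (@le_trans _ _ (h * (2 * N%:R * (1 + N%:R) + 1))).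
      by rewrite mulrDr mulr1 !mulrA [leRHS]addrC mulrC !mulrA ler_wpDl// ltW.
    rewrite -ler_pdivlMr//; near: h; apply: nbhs_right_le; exact: divr_gt0.
have [dl /= dl0 Hdl] := near1.
exists dl => // h /andP[]; rewrite normr_gt0 => h0 hd.
have abs_near : [/\ forall y, y \in F -> forall t, 0 <= t ->
         `|v (`|h| + t) y - v t y| <= (1 + N%:R) * `|h|,
       forall t, 0 <= t ->
    `|v (`|h| + t) x - v t x - `|h| * \sum_(i < N) (v t (J x i) - v t x)|
      <= (e / 2) * `|h|,
       `|h| < t & 2 * N%:R * ((1 + N%:R) * `|h|) <= e / 2].
  apply: Hdl; last by rewrite normr_gt0.
  by rewrite /= sub0r normrN normr_id.
case: abs_near => lip inc ht small.
have [hp|hn|h00] := ltgtP 0 h; last by rewrite h00 eqxx in h0.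
  rewrite gtr0_norm// in inc *; apply: (le_trans (inc _ (ltW t0))).
  by rewrite ler_wpM2r ?ltW// ltr_pdivrMr// ltr_pMr// ltr1n.
rewrite ltr0_norm// in lip inc ht small *.
pose s := h + t.
have s0 : 0 <= s by rewrite /s; lra.
have ts : t = - h + s by rewrite /s; ring.
have := inc s s0; rewrite -ts -/s.
have xF : x \in F by rewrite mem_head.
have JF i : J x i \in F.
  by rewrite inE; apply/orP; right; apply/mapP; exists i; rewrite ?mem_enum.
have : `|\sum_(i < N) (v t (J x i) - v t x) - \sum_(i < N) (v s (J x i) - v s x)| <=
    2 * N%:R * ((1 + N%:R) * - h).
  rewrite -sumrB; apply: (le_trans (ler_norm_sum _ _ _)).
  rewrite (_ : 2 * N%:R * ((1 + N%:R) * - h) =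
     \sum_(i < N) (2 * ((1 + N%:R) * - h))); last first.
    by rewrite sumr_const card_ord -[RHS]mulr_natl; ring.
  apply: ler_sum => i _.
  have := lip _ xF s s0; have := lip _ (JF i) s s0; rewrite -ts.
  by rewrite !ler_norml => /andP[? ?] /andP[? ?]; apply/andP; split; lra.
set A := (X in `|X - _| <= 2 * _ * _ -> _); set B := (X in - h * X) => dAB dv.
have {}dAB : `|A - B| <= e / 2 by exact: le_trans dAB small.
change (is_true (`|v s x - v t x - h * A| <= e * - h)).
rewrite -/s [X in `|X| <= _](_ : _ = - (v t x - v s x - - h * B) - h * (A - B));
  last by ring.
apply: (le_trans (ler_normB _ _)); rewrite normrN normrM ltr0_norm//.
have -> : e * - h = e / 2 * - h + - h * (e / 2) by field.
by rewrite lerD// ler_wpM2l// oppr_ge0 ltW.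
Unshelve. all: by end_near. Qed.

Lemma hitting_at0 x : v 0 x = (x \in E)%:R.
Proof.
rewrite /hitting (_ : \esum_(y in E) _ = (x \in E)%:R%:E)//.
have p0 y : p 0 x y = (x == y)%:R by case: tfp.
under eq_esum do rewrite p0.
have [xE|xE] := boolP (x \in E).
  rewrite (esumID [set x]); last by move=> y _; rewrite lee_fin.
  rewrite (_ : E `&` [set x] = [set x]); last first.
    by apply/seteqP; split => [y []//|y ->]; split => //; exact: set_mem.
  rewrite esum_set1 ?eqxx// esum1 ?adde0// => y [_ yx].
  by case: eqP => // xy; case: yx.
rewrite esum1// => y Ey; case: eqP => // xy.
by move: xE; rewrite xy mem_set.
Qed.

End semigroup.

(** * Complete symmetric polynomials *)

Section complete_symmetric.

(** [complete_sym] on a family instead of a tuple, so that dropping the first variable is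
    composition with [lift ord0]. *)
Definition hsum (A : comNzRingType) (N l : nat) (f : 'I_N -> A) : A :=
  \sum_(s : l.-tuple 'I_N | sorted leq [seq val i | i <- s]) \prod_(i <- s) f i.

Lemma hsum0 (A : comNzRingType) (N : nat) (f : 'I_N -> A) : hsum 0 f = 1.
Proof.
rewrite /hsum (big_pred1 [tuple]) ?big_nil// => s.
by rewrite [s]tuple0/= eqxx.
Qed.

Lemma hsum_ord0 (A : comNzRingType) (l : nat) (f : 'I_0 -> A) : hsum l.+1 f = 0.
Proof. by rewrite /hsum big1// => s; have [] := thead s. Qed.

(** Weakly increasing index tuples are split by whether their first entry is 0; if it is not, no
    entry is. *)
Lemma hsumS (A : comNzRingType) (N l : nat) (f : 'I_N.+1 -> A) :
  hsum l.+1 f = f ord0 * hsum l f + hsum l.+1 (f \o lift ord0).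
Proof.
rewrite {1}/hsum (bigID (fun s : l.+1.-tuple 'I_N.+1 => thead s == ord0))/=.
congr (_ + _).
  rewrite /hsum mulr_sumr.
  rewrite (reindex_onto (fun s : l.-tuple 'I_N.+1 => [tuple of ord0 :: s])
            (fun s => [tuple of behead s]))/=; last first.
    move=> s /andP[_]; case/tupleP: s => i s; rewrite theadE => /eqP ->.
    exact: val_inj.
  apply: eq_big => [s|s _]; last by rewrite big_cons.
  rewrite theadE eqxx andbT (_ : _ == s); last by apply/eqP/val_inj.
  by rewrite andbT path_min_sorted//; apply/allP.
case: N f => [|N] f.
  rewrite hsum_ord0 big1// => s /andP[_].
  by rewrite (ord1 (thead s)) eqxx.
rewrite /hsum (reindex_onto (fun s : l.+1.-tuple 'I_N.+1 => map_tuple (lift ord0) s)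
   (fun s => map_tuple (fun i : 'I_N.+2 => inord i.-1) s))/=; last first.
  move=> s /andP[ss s0]; apply: val_inj => /=; rewrite -map_comp map_id_in// => i si.
  suff i0 : (0 < i)%N.
    apply: val_inj; rewrite /= /bump/= inordK ?add1n ?prednK//.
    by case: i i0 {si} => -[].
  move: ss s0 si; rewrite (tuple_eta s)/= theadE inE lt0n.
  rewrite path_sortedE; last exact: leq_trans.
  move=> /andP[/allP h _] s0 /orP[/eqP->//|si].
  have := h i; rewrite map_f// => /(_ isT); rewrite -lt0n; apply: leq_trans.
 by rewrite lt0n; apply: contraNneq s0 => s0; apply/eqP/val_inj; rewrite /= s0. 
apply: eq_big => [s|s _]; last by rewrite big_map.
rewrite (_ : _ == s); last first.
  apply/eqP/val_inj => /=; rewrite -map_comp map_id_in// => i _.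
  by apply: val_inj; rewrite /= /bump/= add0n inord_val.
rewrite andbT (_ : thead _ != ord0) ?andbT; last first.
  by rewrite /thead tnth_map.
rewrite -map_comp (eq_map (g := S \o val)) // map_comp sorted_map.
by apply: eq_sorted => a b /=; rewrite ltnS.
Qed.

(** Newton-like recursion on N and l, valid also for coinciding nodes. N = l = 0 is excluded: a
    polynomial of size 0 has constant term 0, while h_0 = 1. *)
Lemma hsum_interpolation (F : fieldType) (N l : nat) (xi : 'I_N -> F) :
  (forall i, xi i != 0) -> (0 < N + l)%N ->
  exists R : {poly F}, [/\ (size R <= N)%N,
    forall i, R.[(xi i)^-1] = xi i ^+ l & R`_0 = hsum l xi].
Proof.
elim: N l xi => [|N IHN] l xi xi0.
  case: l => // l _; exists 0; split; rewrite ?size_poly0 ?hsum_ord0 ?coef0//.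
  by case.
elim: l => [|l IHl] _.
  exists 1; split; rewrite ?size_poly1 ?hsum0 ?coef1// => i.
  by rewrite hornerE expr0.
have [R [sR eR R0]] := IHl isT.
have [|Q [sQ eQ Q0]] := IHN l.+1 (xi \o lift ord0) (fun i => xi0 _).
  by rewrite addnS.
(* With b = 1/xi_j the first factor is 1 - xi_0/xi_j: it kills Q at the node of index 0, and at the
   others (1 - xi_0/xi_j) xi_j^(l+1) + xi_0 xi_j^l = xi_j^(l+1). The constant terms satisfy
   [hsumS]. *)
exists ((1 - xi ord0 *: 'X) * Q + xi ord0 *: R); split.
- rewrite (leq_trans (size_polyD _ _))// geq_max; apply/andP; split; last first.
    by rewrite (leq_trans (size_scale_leq _ _)).
  rewrite (leq_trans (size_polyMleq _ _))//.
  have s2 : (size (1 - xi ord0 *: 'X)%R <= 2)%N.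
    rewrite (leq_trans (size_polyD _ _))// geq_max size_poly1 size_polyN/=.
    by rewrite (leq_trans (size_scale_leq _ _))// size_polyX.
  by have := leq_add s2 sQ; rewrite add2n; case: (_ + _)%N.
- move=> i; rewrite !hornerE eR exprS; case: (unliftP ord0 i) => [j ->|->].
    have := eQ j; rewrite /= => ->; rewrite exprS.
    by field.
  by rewrite divff// subrr mul0r add0r.
- rewrite hsumS coefD coefZ mulrBl mul1r -scalerAl coefB coefZ coefXM/=.
  by rewrite mulr0 subr0 R0 Q0 addrC.
Qed.

End complete_symmetric.

(** * Products over pairs of indices *)

Section vandermonde.
Variable F : fieldType.

Lemma prod_pairs (N : nat) (f : 'I_N -> F) :
  \prod_(i < N) \prod_(j < N | (i < j)%N) (f i * f j) = \prod_(i < N) f i ^+ N.-1.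
Proof.
under eq_bigr do rewrite big_split/=.
rewrite big_split/= [X in _ * X](exchange_big_dep xpredT)//= -big_split/=.
apply: eq_bigr => i _.
rewrite !prodr_const -exprD; congr (_ ^+ _).
rewrite -[RHS](_ : #|[pred j : 'I_N | j != i]| = _); last first.
  by rewrite -[in RHS](card_ord N) (cardC1 i).
rewrite -[RHS](cardID [pred j : 'I_N | (i < j)%N]).
by congr (_ + _)%N; apply: eq_card => j; rewrite !inE -val_eqE/=; lia.
Qed.

Lemma prod_pairsN1 (N : nat) :
  \prod_(i < N) \prod_(j < N | (i < j)%N) (-1) = (-1) ^+ (N * N.-1)./2 :> F.
Proof.
elim: N => [|N IH]; first by rewrite big_ord0.
rewrite big_ord_recl big_mkcond big_ord_recl /= mul1r prodr_const card_ord.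
rewrite (_ : (N.+1 * N)./2 = N + (N * N.-1)./2)%N; last first.
  by rewrite -!bin2; case: N {IH} => // n; rewrite binS bin1 addnC.
rewrite exprD -IH; congr (_ * _); apply: eq_bigr => i _.
rewrite big_mkcond big_ord_recl/= mul1r -big_mkcond/=.
by apply: eq_bigl => j; rewrite /bump.
Qed.

End vandermonde.

(** * Vandermonde-type determinants *)

Section determinants.
Variable F : fieldType.

Lemma det_powers (N : nat) (a : 'I_N -> F) :
  \det (\matrix_(k < N, i < N) a i ^+ k) =
  \prod_(i < N) \prod_(j < N | (i < j)%N) (a j - a i).
Proof.
have := det_Vandermonde (\row_i a i).
rewrite (_ : Vandermonde N _ = \matrix_(k < N, i < N) a i ^+ k); last first.
  by apply/matrixP => i j; rewrite !mxE.
by move=> ->; apply: eq_bigr => i _; apply: eq_bigr => j _; rewrite !mxE.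
Qed.

(** 1/(1-b) - 1/(1-a) = (b-a)/((1-a)(1-b)), and every index occurs in N-1 pairs. *)
Lemma det_powers_inv_onem (N : nat) (xi : 'I_N -> F) :
  (forall i, 1 - xi i != 0) ->
  \det (\matrix_(k < N, i < N) (1 - xi i)^-1 ^+ k) =
  \prod_(i < N) \prod_(j < N | (i < j)%N) (xi j - xi i)
  * \prod_(i < N) (1 - xi i) ^- N.-1.
Proof.
move=> xi1; rewrite det_powers.
under [X in _ * X]eq_bigr do rewrite -exprVn.
rewrite -prod_pairs -big_split/=; apply: eq_bigr => i _.
rewrite -big_split/=; apply: eq_bigr => j _.
by field; rewrite xi1 xi1.
Qed.

Lemma det_powers_inv (N : nat) (xi : 'I_N -> F) : (forall i, xi i != 0) ->
  \det (\matrix_(k < N, i < N) (xi i)^-1 ^+ k) =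
  (-1) ^+ (N * N.-1)./2
  * \prod_(i < N) \prod_(j < N | (i < j)%N) (xi j - xi i)
  * \prod_(i < N) xi i ^- N.-1.
Proof.
move=> xi0; rewrite det_powers.
under [X in _ * X]eq_bigr do rewrite -exprVn.
rewrite -prod_pairs -prod_pairsN1 -!big_split/=; apply: eq_bigr => i _.
rewrite -!big_split/=; apply: eq_bigr => j _.
by field; rewrite xi0 xi0.
Qed.

(** The rows j >= 1 are divisible by X, so column 0 contains only the constant term of R; the
    remaining block is triangular with the leading coefficients 1 of (X-1)^(j-1) on its diagonal. *)
Lemma det_coefs (N : nat) (R : {poly F}) : (0 < N)%N ->
  \det (\matrix_(j < N, k < N)
    (if j == 0%N :> nat then R else 'X * ('X - 1) ^+ j.-1)`_k) = R`_0.
Proof.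
case: N => // n _.
rewrite (expand_det_col _ ord0) big_ord_recl big1 ?addr0; last first.
  by move=> i _; rewrite mxE /= coefXM/= mul0r.
rewrite mxE /= /cofactor expr0 mul1r det_trig; last first.
  apply/is_trig_mxP => i j ij; rewrite !mxE /= coefXM/=.
  rewrite nth_default//.
  by rewrite size_exp_XsubC /bump/= ?add1n.
rewrite big1 ?mulr1// => i _; rewrite !mxE /= coefXM/= /bump/=.
have := lead_coef_exp ('X - 1 : {poly F}) i.
by rewrite lead_coefXsubC expr1n lead_coefE size_exp_XsubC.
Qed.

(* In the variable b = 1/xi the rows of the left-hand matrix are b^(l+1) times
   b^-l and b(b-1)^(j-1), j >= 1; interpolating b^-l by a polynomial makes the
   change of basis to the powers of b block triangular. *)
Lemma det_columns_eq_hsum (N l : nat) (xi : 'I_N -> F) :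
  (0 < N)%N -> (forall i, xi i != 0) ->
  \det (\matrix_(j < N, i < N)
     (xi i ^- (if j == 0%N :> nat then 1%N else (j.+1 + l)%N)
      * (1 - xi i) ^+ j.-1)) =
  (-1) ^+ (N * N.-1)./2 * hsum l xi
  * \prod_(i < N) \prod_(j < N | (i < j)%N) (xi j - xi i)
  * \prod_(i < N) xi i ^- (N + l).
Proof.
move=> N0 xi0.
have [R [sR eR R0]] := hsum_interpolation (l := l) xi0 (ltn_addr l N0).
pose g (j : 'I_N) := if j == 0%N :> nat then R else 'X * ('X - 1) ^+ j.-1.
have sg j : (size (g j) <= N)%N.
  rewrite /g; case: eqP => // /eqP j0.
  rewrite (leq_trans (size_polyMleq _ _))// size_polyX add2n/=.
  by rewrite size_exp_XsubC prednK ?lt0n.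
pose C := \matrix_(j < N, k < N) (g j)`_k.
pose V := \matrix_(k < N, i < N) (xi i)^-1 ^+ k.
have -> : (\matrix_(j < N, i < N)
     (xi i ^- (if j == 0%N :> nat then 1%N else (j.+1 + l)%N)
      * (1 - xi i) ^+ j.-1)) = C *m V *m diag_mx (\row_i xi i ^- l.+1).
  apply/matrixP => j i; rewrite mul_mx_diag !mxE.
  under eq_bigr do rewrite !mxE.
  rewrite -(horner_coef_wide _ (sg j)) /g.
  case: eqP => [->|/eqP j0].
    rewrite eR /= expr0 mulr1 expr1 [xi i ^+ l.+1]exprS invfM mulrCA.
    by rewrite mulfV ?mulr1// expf_neq0.
  rewrite !hornerE.
  have -> : (xi i)^-1 - 1 = (xi i)^-1 * (1 - xi i) by rewrite mulrBr mulVf// mulr1.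
  have -> : (j.+1 + l = j.-1.+1 + l.+1)%N by rewrite prednK ?lt0n// addnS addSn.
  by rewrite exprMn exprVn exprD exprS !invfM; ring.
rewrite !det_mulmx det_diag det_powers_inv//.
have -> : \det C = hsum l xi by rewrite -R0; exact: det_coefs.
under [X in _ * X]eq_bigr do rewrite mxE.
rewrite !mulrA [hsum l xi * _]mulrC -[LHS]mulrA -big_split/=.
congr (_ * _); apply: eq_bigr => i _.
rewrite -invfM -exprD; congr ((_ ^+ _)^-1).
by move: N0; clear; lia.
Qed.

End determinants.

(** * Complex-valued functions of a real variable *)

Section complex_functions.
Variable R : realType.
Local Notation C := R[i].
Local Notation Re := (@complex.Re R).
Local Notation Im := (@complex.Im R).

Lemma ReM (z w : C) : Re (z * w) = Re z * Re w - Im z * Im w.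
Proof. by case: z => a b; case: w => c d. Qed.

Lemma ImM (z w : C) : Im (z * w) = Re z * Im w + Im z * Re w.
Proof. by case: z => a b; case: w => c d. Qed.

Lemma ReD (z w : C) : Re (z + w) = Re z + Re w.
Proof. by case: z => a b; case: w => c d. Qed.

Lemma ImD (z w : C) : Im (z + w) = Im z + Im w.
Proof. by case: z => a b; case: w => c d. Qed.

Lemma ReN (z : C) : Re (- z) = - Re z. Proof. by case: z. Qed.
Lemma ImN (z : C) : Im (- z) = - Im z. Proof. by case: z. Qed.

Lemma ReV (z : C) : Re z^-1 = Re z / (Re z ^+ 2 + Im z ^+ 2).
Proof. by case: z. Qed.

Lemma ImV (z : C) : Im z^-1 = - (Im z / (Re z ^+ 2 + Im z ^+ 2)).
Proof. by case: z => a b; rewrite /GRing.inv. Qed.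

Lemma complex_ext (z w : C) : Re z = Re w -> Im z = Im w -> z = w.
Proof. by case: z => a b; case: w => c d /= -> ->. Qed.

Lemma sqrReIm_gt0 (z : C) : z != 0 -> 0 < Re z ^+ 2 + Im z ^+ 2.
Proof.
case: z => a b /= z0; rewrite lt_neqAle addr_ge0 ?sqr_ge0// andbT eq_sym.
apply: contra z0; rewrite paddr_eq0 ?sqr_ge0// !sqrf_eq0 => /andP[/eqP-> /eqP->].
by [].
Qed.

(* A submultiplicative norm on C with values in R itself. *)
Definition cabs (z : C) : R := `|Re z| + `|Im z|.

Lemma cabs_ge0 z : 0 <= cabs z. Proof. by rewrite addr_ge0. Qed.

Lemma cabs0 : cabs 0 = 0. Proof. by rewrite /cabs /= normr0 addr0. Qed.

Lemma cabsD z w : cabs (z + w) <= cabs z + cabs w.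
Proof.
rewrite /cabs ReD ImD; have := ler_normD (Re z) (Re w).
by have := ler_normD (Im z) (Im w); lra.
Qed.

Lemma cabsM z w : cabs (z * w) <= cabs z * cabs w.
Proof.
rewrite /cabs ReM ImM; have := ler_normB (Re z * Re w) (Im z * Im w).
have := ler_normD (Re z * Im w) (Im z * Re w).
by rewrite !normrM; nra.
Qed.

Lemma cabs_sum (I : Type) (s : seq I) (f : I -> C) :
  cabs (\sum_(i <- s) f i) <= \sum_(i <- s) cabs (f i).
Proof.
elim: s => [|i s IH]; first by rewrite !big_nil cabs0.
by rewrite !big_cons (le_trans (cabsD _ _))// lerD.
Qed.

Lemma cabs_prod (I : Type) (s : seq I) (f : I -> C) :
  cabs (\prod_(i <- s) f i) <= \prod_(i <- s) cabs (f i).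
Proof.
elim: s => [|i s IH].
  by rewrite !big_nil /cabs /= normr1 normr0 addr0.
rewrite !big_cons (le_trans (cabsM _ _))// ler_pM// ?cabs_ge0//.
Qed.

Lemma cabs_sign (b : bool) (z : C) : cabs ((-1) ^+ b * z) = cabs z.
Proof.
by case: b; rewrite ?expr0 ?mul1r// expr1 mulN1r /cabs ReN ImN !normrN.
Qed.

Lemma cabs_cexp (z : C) : cabs (cexp z) <= 2 * expR (Re z).
Proof.
case: z => a b; rewrite /cabs /= !normrM !(ger0_norm (expR_ge0 _)).
rewrite -mulrDr mulrC ler_wpM2r ?expR_ge0//.
by rewrite lerD// ler_norml ?cos_geN1 ?cos_le1 ?sin_geN1 ?sin_le1.
Qed.

Definition ccont (f : R -> C) : Prop :=
  continuous (fun x => Re (f x)) /\ continuous (fun x => Im (f x)).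

Lemma ccont_cst (c : C) : ccont (fun=> c).
Proof. by split=> x; exact: cst_continuous. Qed.

Lemma ccontD f g : ccont f -> ccont g -> ccont (fun x => f x + g x).
Proof.
move=> [f1 f2] [g1 g2]; split=> x.
  under eq_fun do rewrite ReD; exact: continuousD (f1 x) (g1 x).
under eq_fun do rewrite ImD; exact: continuousD (f2 x) (g2 x).
Qed.

Lemma ccontN f : ccont f -> ccont (fun x => - f x).
Proof.
move=> [f1 f2]; split=> x.
  under eq_fun do rewrite ReN; exact: continuousN (f1 x).
under eq_fun do rewrite ImN; exact: continuousN (f2 x).
Qed.

Lemma ccontM f g : ccont f -> ccont g -> ccont (fun x => f x * g x).
Proof.
move=> [f1 f2] [g1 g2]; split=> x.
  under eq_fun do rewrite ReM.
  exact: continuousB (continuousM (f1 x) (g1 x)) (continuousM (f2 x) (g2 x)).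
under eq_fun do rewrite ImM.
exact: continuousD (continuousM (f1 x) (g2 x)) (continuousM (f2 x) (g1 x)).
Qed.

Lemma ccontV f : (forall x, f x != 0) -> ccont f -> ccont (fun x => (f x)^-1).
Proof.
move=> f0 [f1 f2].
have cn x : {for x, continuous (fun x => (Re (f x) ^+ 2 + Im (f x) ^+ 2)^-1)}.
  apply: continuousV; first by rewrite gt_eqF// sqrReIm_gt0.
  exact: continuousD (continuousM (f1 x) (f1 x)) (continuousM (f2 x) (f2 x)).
split=> x.
  under eq_fun do rewrite ReV; exact: continuousM (f1 x) (cn x).
under eq_fun do rewrite ImV; exact: continuousN (continuousM (f2 x) (cn x)).
Qed.

Lemma ccontX f n : ccont f -> ccont (fun x => f x ^+ n).
Proof.
move=> cf; elim: n => [|n IH]; first by under eq_fun do rewrite expr0; exact: ccont_cst.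
by under eq_fun do rewrite exprS; exact: ccontM.
Qed.

Lemma ccontXz f (n : int) : (forall x, f x != 0) -> ccont f -> ccont (fun x => f x ^ n).
Proof.
move=> f0 cf; case: n => n; first exact: ccontX.
under eq_fun do rewrite NegzE -exprnN.
by apply: ccontV; [move=> x; rewrite expf_neq0|exact: ccontX].
Qed.

Lemma ccont_sum (I : Type) (s : seq I) (f : I -> R -> C) :
  (forall i, ccont (f i)) -> ccont (fun x => \sum_(i <- s) f i x).
Proof.
move=> cf; elim: s => [|i s IH].
  by under eq_fun do rewrite big_nil; exact: ccont_cst.
by under eq_fun do rewrite big_cons; exact: ccontD.
Qed.

Lemma ccont_cexp f : ccont f -> ccont (fun x => cexp (f x)).
Proof.
move=> [f1 f2].
have ce x : {for x, continuous (fun x => expR (Re (f x)))}.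
  by apply: (continuous_comp (f1 x)); exact: continuous_expR.
have cc x : {for x, continuous (fun x => cos (Im (f x)))}.
  by apply: (continuous_comp (f2 x)); exact: continuous_cos.
have cs x : {for x, continuous (fun x => sin (Im (f x)))}.
  by apply: (continuous_comp (f2 x)); exact: continuous_sin.
split=> x.
  rewrite (_ : (fun x => _) = fun x => expR (Re (f x)) * cos (Im (f x))); last first.
    by apply/funext => y; case: (f y).
  exact: continuousM (ce x) (cc x).
rewrite (_ : (fun x => _) = fun x => expR (Re (f x)) * sin (Im (f x))); last first.
  by apply/funext => y; case: (f y).
exact: continuousM (ce x) (cs x).
Qed.

Lemma ccont_cabs f : ccont f -> continuous (fun x => cabs (f x)).
Proof.
move=> [f1 f2] x.
have c1 : {for x, continuous (fun x => `|Re (f x)|)}.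
  by apply: (continuous_comp (f1 x)); exact: norm_continuous.
have c2 : {for x, continuous (fun x => `|Im (f x)|)}.
  by apply: (continuous_comp (f2 x)); exact: norm_continuous.
exact: continuousD c1 c2.
Qed.

Lemma continuous_integrable (a b : R) (f : R -> R) : continuous f ->
  lebesgue_measure.-integrable `[a, b] (EFin \o f).
Proof.
move=> cf; apply: continuous_compact_integrable; first exact: segment_compact.
exact: continuous_subspaceT.
Qed.

Lemma eq_Cintegral (a b : R) (f g : R -> C) : f =1 g ->
  Cintegral a b f = Cintegral a b g.
Proof. by move=> /funext ->. Qed.

Lemma CintegralD (a b : R) f g : ccont f -> ccont g ->
  Cintegral a b (fun x => f x + g x) = Cintegral a b f + Cintegral a b g.
Proof.
move=> [f1 f2] [g1 g2]; apply: complex_ext; rewrite ?ReD ?ImD /=.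
  under eq_Rintegral do rewrite ReD.
  by rewrite RintegralD//; exact: continuous_integrable.
under eq_Rintegral do rewrite ImD.
by rewrite RintegralD//; exact: continuous_integrable.
Qed.

Lemma CintegralZ (a b : R) (c : C) f : ccont f ->
  Cintegral a b (fun x => c * f x) = c * Cintegral a b f.
Proof.
move=> [f1 f2].
have cZ (k : R) (g : R -> R) : continuous g -> continuous (fun x => k * g x).
  by move=> cg x; apply: continuousM; [exact: cst_continuous|exact: cg].
apply: complex_ext; rewrite ?ReM ?ImM /=.
  under eq_Rintegral do rewrite ReM.
  by rewrite RintegralB// ?RintegralZl//; try exact: continuous_integrable;
    apply: continuous_integrable; exact: cZ.
under eq_Rintegral do rewrite ImM.
by rewrite RintegralD// ?RintegralZl//; try exact: continuous_integrable;
  apply: continuous_integrable; exact: cZ.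
Qed.

Lemma Cintegral_sum (a b : R) (I : Type) (s : seq I) (f : I -> R -> C) :
  (forall i, ccont (f i)) ->
  Cintegral a b (fun x => \sum_(i <- s) f i x) = \sum_(i <- s) Cintegral a b (f i).
Proof.
move=> cf; elim: s => [|i s IH].
  rewrite big_nil; apply: complex_ext => /=.
    under eq_Rintegral do rewrite big_nil.
    by rewrite Rintegral_cst// mul0r.
  under eq_Rintegral do rewrite big_nil.
  by rewrite Rintegral_cst// mul0r.
rewrite big_cons -IH -CintegralD//; last exact: ccont_sum.
by apply: eq_Cintegral => x; rewrite big_cons.
Qed.

(** The factor 2 comes from estimating the real and imaginary parts separately. *)
Lemma cabs_Cintegral_le (b M : R) f : 0 <= b -> ccont f ->
  (forall x, 0 <= x <= b -> cabs (f x) <= M) ->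
  cabs (Cintegral 0 b f) <= 2 * b * M.
Proof.
move=> b0 [f1 f2] fM.
have bnd (g : R -> R) : continuous g -> (forall x, 0 <= x <= b -> `|g x| <= M) ->
    `|\int[lebesgue_measure]_(x in `[0, b]) g x| <= b * M.
  move=> cg gM; apply: (le_trans (le_normr_Rintegral _ _)) => //.
    exact: continuous_integrable.
  apply: (@le_trans _ _ (\int[lebesgue_measure]_(x in `[0, b]) M)).
    apply: le_Rintegral => //.
    - apply: continuous_integrable => x.
      by apply: (continuous_comp (cg x)); exact: norm_continuous.
    - by apply: continuous_integrable => x; exact: cst_continuous.
  rewrite Rintegral_cst; last exact: measurable_itv.
  rewrite /= lebesgue_measure_itv/= lte_fin.
  rewrite mulrC; case: ltP => b00; first by rewrite oppr0 addr0.
  by rewrite /= (_ : b = 0)//; apply/eqP; rewrite eq_le b0 b00.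
have := bnd _ f1; have := bnd _ f2 => H2 H1.
rewrite {1}/cabs /= -mulrA mulr_natl mulr2n lerD//.
  apply: H1 => x /fM; apply: le_trans; rewrite /cabs lerDl//.
by apply: H2 => x /fM; apply: le_trans; rewrite /cabs lerDr//.
Qed.

End complex_functions.

(** * Differentiation of complex-valued functions *)

Section complex_derivative.
Variable R : realType.
Local Notation C := R[i].
Local Notation Re := (@complex.Re R).
Local Notation Im := (@complex.Im R).

Definition cderiv (f : R -> C) (t : R) (df : C) : Prop :=
  is_derive t 1 (fun x => Re (f x)) (Re df) /\
  is_derive t 1 (fun x => Im (f x)) (Im df).

Lemma cderiv_cst (c : C) t : cderiv (fun=> c) t 0.
Proof. by split; exact: is_derive_cst. Qed.

Lemma cderivD f g t df dg : cderiv f t df -> cderiv g t dg ->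
  cderiv (fun x => f x + g x) t (df + dg).
Proof.
move=> [f1 f2] [g1 g2]; split.
  by under eq_fun do rewrite ReD; rewrite ReD; exact: is_deriveD.
by under eq_fun do rewrite ImD; rewrite ImD; exact: is_deriveD.
Qed.

Lemma cderivM f g t df dg : cderiv f t df -> cderiv g t dg ->
  cderiv (fun x => f x * g x) t (df * g t + f t * dg).
Proof.
move=> [f1 f2] [g1 g2]; split.
  under eq_fun do rewrite ReM.
  apply: (is_derive_eq (is_deriveB (is_deriveM f1 g1) (is_deriveM f2 g2))).
  by rewrite /GRing.scale/= ReD !ReM; ring.
under eq_fun do rewrite ImM.
apply: (is_derive_eq (is_deriveD (is_deriveM f1 g2) (is_deriveM f2 g1))).
by rewrite /GRing.scale/= ImD !ImM; ring.
Qed.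

Lemma cderivZ (c : C) f t df : cderiv f t df -> cderiv (fun x => c * f x) t (c * df).
Proof.
by move=> /(cderivM (cderiv_cst c t)); rewrite mul0r add0r.
Qed.

Lemma cderiv_sum (I : Type) (s : seq I) (f : I -> R -> C) (df : I -> C) t :
  (forall i, cderiv (f i) t (df i)) ->
  cderiv (fun x => \sum_(i <- s) f i x) t (\sum_(i <- s) df i).
Proof.
move=> Df; elim: s => [|i s IH].
  by rewrite big_nil; under eq_fun do rewrite big_nil; exact: cderiv_cst.
by rewrite big_cons; under eq_fun do rewrite big_cons; exact: cderivD.
Qed.

Lemma cderiv_prod (n : nat) (f : 'I_n -> R -> C) (df : 'I_n -> C) t :
  (forall i, cderiv (f i) t (df i)) ->
  cderiv (fun x => \prod_(i < n) f i x) t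
    (\sum_(i < n) df i * \prod_(j < n | j != i) f j t).
Proof.
elim: n f df => [|n IH] f df Df.
  rewrite big_ord0; under eq_fun do rewrite big_ord0; exact: cderiv_cst.
under eq_fun do rewrite big_ord_recl.
rewrite big_ord_recl.
have := cderivM (Df ord0) (IH _ _ (fun i => Df (lift ord0 i))).
congr (cderiv _ _ (_ * _ + _)).
  by rewrite [RHS]big_mkcond big_ord_recl/= mul1r.
rewrite mulr_sumr; apply: eq_bigr => i _.
rewrite mulrCA; congr (_ * _).
rewrite [RHS]big_mkcond big_ord_recl /= -big_mkcond/=.
by congr (_ * _); apply: eq_bigl => j.
Qed.

Lemma cderiv_Cintegral (a b t : R) (G w : R -> C) : ccont G -> ccont w ->
  cderiv (fun t => Cintegral a b (fun x => G x * cexp (w x * t%:C%C))) t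
    (Cintegral a b (fun x => G x * w x * cexp (w x * t%:C%C))).
Proof.
move=> cG cw.
have half (H : R -> C) : ccont H ->
    is_derive t 1 (fun t => \int[lebesgue_measure]_(x in `[a, b])
        Re (H x * cexp (w x * t%:C%C)))
      (\int[lebesgue_measure]_(x in `[a, b])
        Re (H x * w x * cexp (w x * t%:C%C))).
  move=> cH.
  pose f (t x : R) := Re (H x * cexp (w x * t%:C%C)).
  have fE (t' x : R) : f t' x = expR (Re (w x) * t') *
      (Re (H x) * cos (Im (w x) * t') - Im (H x) * sin (Im (w x) * t')).
    rewrite /f; case: (w x) => c d; case: (H x) => p q /=.
    by rewrite mulr0 mulr0 subr0 add0r; ring.
  have dfE (t' x : R) : Re (H x * w x * cexp (w x * t'%:C%C)) =
     expR (Re (w x) * t') * (Re (H x * w x) * cos (Im (w x) * t')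
        - Im (H x * w x) * sin (Im (w x) * t')).
    case: (w x) => c d; case: (H x) => p q /=.
    by rewrite mulr0 mulr0 subr0 add0r; ring.
  have Df (t' x : R) : is_derive t' 1 (f ^~ x)
      (Re (H x * w x * cexp (w x * t'%:C%C))).
    rewrite (_ : f ^~ x = fun t' => expR (Re (w x) * t') *
      (Re (H x) * cos (Im (w x) * t') - Im (H x) * sin (Im (w x) * t'))); last first.
      by apply/funext => t''; rewrite fE.
    rewrite dfE; move: (H x) (w x) => [p q] [c d] /=.
    apply: is_derive_eq; rewrite /GRing.scale/=; ring.
  have ccw (t' : R) : ccont (fun x => cexp (w x * t'%:C%C)).
    by apply: ccont_cexp; apply: ccontM => //; exact: ccont_cst.
  have intf t' : lebesgue_measure.-integrable `[a, b] (EFin \o f t').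
    by apply: continuous_integrable; case: (ccontM cH (ccw t')).
  (* K bounds the absolute value of the time on the interval ]t - 1, t + 1[, so g dominates the
     derivative there. *)
  pose K := `|t| + 1.
  pose g (x : R) := cabs (H x * w x) * expR (`|Re (w x)| * K).
  have cg : continuous g.
    move=> x.
    have c0 : {for x, continuous (fun x => `|Re (w x)|)}.
      by apply: (continuous_comp (cw.1 x)); exact: norm_continuous.
    have c1 : {for x, continuous (fun x => `|Re (w x)| * K)}.
      have ck : {for x, continuous (fun _ : R => K)} by exact: cst_continuous.
      exact: continuousM c0 ck.
    have c2 : {for x, continuous (fun x => expR (`|Re (w x)| * K))}.
      by apply: (continuous_comp c1); exact: continuous_expR.
    have c3 : {for x, continuous (fun x => cabs (H x * w x))}.
      exact: (ccont_cabs (ccontM cH cw)).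
    have := continuousM c3 c2; exact.
  have g0 x : 0 <= g x by rewrite mulr_ge0 ?cabs_ge0 ?expR_ge0.
  have ub x y : [set` `]t - 1, t + 1[] x -> [set` `[a, b]] y ->
      `|partial1of2 f x y| <= g y.
    move=> /=; rewrite in_itv/= => xt _.
    have ? := Df x y; rewrite partial1of2E derive_val dfE normrM ger0_norm ?expR_ge0//.
    rewrite /g mulrC ler_pM ?expR_ge0//.
      rewrite (le_trans (ler_normB _ _))// !normrM /cabs lerD//.
        by rewrite ler_piMr// ler_norml cos_geN1 cos_le1.
      by rewrite ler_piMr// ler_norml sin_geN1 sin_le1.
    rewrite ler_expR (le_trans (ler_norm _))// normrM ler_wpM2l//.
    rewrite /K ler_norml; case/andP: xt => h1 h2.
    have := ler_norm t; have := ler_norm (- t); rewrite normrN => ? ?.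
    by apply/andP; split; lra.
  have tI : [set` `]t - 1, t + 1[] t.
    by rewrite /= in_itv/=; apply/andP; split; lra.
  have D x y : [set` `]t - 1, t + 1[] x -> [set` `[a, b]] y -> derivable (f ^~ y) x 1.
    by move=> _ _; have [] := Df x y.
  have h1 := @derivable_under_integral R _ _ lebesgue_measure f `[a, b]
    (measurable_itv _) t _ _ tI (fun x _ => intf x) D g g0
    (continuous_integrable _ _ cg) ub.
  have h2 := @differentiation_under_integral R _ _ lebesgue_measure f `[a, b]
    (measurable_itv _) t _ _ tI (fun x _ => intf x) D g g0
    (continuous_integrable _ _ cg) ub.
  apply: DeriveDef => //; rewrite -derive1E h2.
  by apply: eq_Rintegral => y _; have ? := Df t y; rewrite partial1of2E derive_val.
split; first exact: half.
(* The imaginary part of z is the real part of -i z, so the real case applies with G multiplied by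
   -i. *)
have := half (fun x => - 'i%C * G x) (ccontM (ccont_cst _) cG).
have iRe (z : C) : Re (- 'i%C * z) = Im z.
  by case: z => p q; rewrite /=; ring.
rewrite (_ : (fun t => _) = (fun t => \int[lebesgue_measure]_(x in `[a, b])
        Im (G x * cexp (w x * t%:C%C)))); last first.
  by apply/funext => u; apply: eq_Rintegral => x _; rewrite -mulrA iRe.
congr (is_derive _ _ _ _).
by apply: eq_Rintegral => x _; rewrite -!mulrA iRe.
Qed.

End complex_derivative.

(** * Contour integrals *)

Section contour.
Variable R : realType.
Local Notation C := R[i].
Local Notation Re := (@complex.Re R).
Local Notation Im := (@complex.Im R).

Lemma cexp_iD (a b : R) :
  cexp (Complex 0 (a + b)) = cexp (Complex 0 a) * cexp (Complex 0 b).
Proof.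
apply: complex_ext; rewrite ?ReM ?ImM /= expR0 !mul1r ?cosD ?sinD//.
by rewrite addrC mulrC [X in _ + X]mulrC addrC.
Qed.

Lemma cexp_i0 : cexp (Complex 0 0 : C) = 1.
Proof. by rewrite /= expR0 cos0 sin0 !mul1r. Qed.

Lemma cexp_i_neq0 (a : R) : cexp (Complex 0 a) != 0.
Proof.
apply/eqP => h; have := cexp_iD a (- a).
by rewrite subrr cexp_i0 h mul0r => /eqP; rewrite oner_eq0.
Qed.

Lemma cexp_iXz (a : R) (m : int) :
  cexp (Complex 0 a) ^ m = cexp (Complex 0 (m%:~R * a)).
Proof.
have nat_case n : cexp (Complex 0 a) ^+ n = cexp (Complex 0 (n%:R * a)).
  elim: n => [|n IH]; first by rewrite mul0r cexp_i0.
  by rewrite exprS IH -cexp_iD -natr1 mulrDl mul1r addrC.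
case: m => n; first by rewrite -exprnP nat_case.
rewrite NegzE -exprnN nat_case; apply: (mulfI (cexp_i_neq0 (n.+1%:R * a))).
by rewrite mulfV ?cexp_i_neq0// -cexp_iD mulrNz mulNr subrr cexp_i0.
Qed.

Lemma cexp_2pi (m : int) : cexp (Complex 0 (m%:~R * (2 * pi))) = 1 :> C.
Proof.
rewrite -cexp_iXz mulr_natl /= expR0 !mul1r cos2pi sin2pi.
exact: exp1rz.
Qed.

(** The only circle integral evaluated directly, by antiderivatives; the values at time 0 are all
    derived from it. *)
Lemma Cintegral_cexp_i (m : int) :
  Cintegral 0 (2 * pi) (fun th => cexp (Complex 0 (m%:~R * th)))
  = if m == 0 then (2 * pi)%:C%C else 0 :> C.
Proof.
have pi20 : 0 < 2 * pi :> R by rewrite mulr_gt0 ?pi_gt0.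
case: eqVneq => [->|m0].
  apply: complex_ext => /=.
    under eq_Rintegral do rewrite mul0r expR0 cos0 mulr1.
    rewrite Rintegral_cst; last exact: measurable_itv.
    by rewrite /= lebesgue_measure_itv/= lte_fin pi20 /= mul1r subr0.
  under eq_Rintegral do rewrite mul0r sin0 mulr0.
  by rewrite Rintegral_cst ?mul0r//; exact: measurable_itv.
have mR0 : m%:~R != 0 :> R by rewrite intr_eq0.
have FTC (f F : R -> R) : continuous f -> (forall x : R, is_derive x 1 F (f x)) ->
    F 0 = F (2 * pi) -> \int[lebesgue_measure]_(x in `[0, 2 * pi]) f x = 0.
  move=> cf DF F02.
  have cF (x : R) : {for x, continuous F}.
    by apply: differentiable_continuous; apply/derivable1_diffP; have [] := DF x.
  rewrite /Rintegral (@continuous_FTC2 _ f F)//.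
  - by rewrite F02 subee.
  - exact: continuous_subspaceT.
  - split; [by move=> x _; have [] := DF x| |].
      exact: cvg_at_right_filter (cF 0).
    exact: cvg_at_left_filter (cF (2 * pi)).
  - by move=> x _; rewrite derive1E; have ? := DF x; rewrite derive_val.
have [c2 s2] : cos (m%:~R * (2 * pi)) = 1 :> R /\ sin (m%:~R * (2 * pi)) = 0 :> R.
  by have := cexp_2pi m; rewrite /= expR0 !mul1r => -[-> ->].
have clin (x : R) : {for x, continuous (fun th : R => m%:~R * th)}.
  have ck : {for x, continuous (fun _ : R => m%:~R : R)} by exact: cst_continuous.
  exact: continuousM ck (@cvg_id _ _).
apply: complex_ext => /=.
  under eq_Rintegral do rewrite expR0 mul1r.
  apply: (FTC _ (fun x => m%:~R^-1 * sin (m%:~R * x))).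
  - by move=> x; apply: (continuous_comp (clin x)); exact: continuous_cos.
  - by move=> x; apply: is_derive_eq; rewrite /GRing.scale/=; field.
  - by rewrite mulr0 sin0 s2.
under eq_Rintegral do rewrite expR0 mul1r.
apply: (FTC _ (fun x => - m%:~R^-1 * cos (m%:~R * x))).
- by move=> x; apply: (continuous_comp (clin x)); exact: continuous_sin.
- by move=> x; apply: is_derive_eq; rewrite /GRing.scale/=; field.
- by rewrite mulr0 cos0 c2.
Qed.

Local Arguments cexp : simpl never.

Variable r : R.
Hypotheses (r0 : 0 < r) (r1 : r < 1).

Definition circ (th : R) : C := (r%:C * cexp (Complex 0 th))%C.

Lemma circ_neq0 th : circ th != 0.
Proof.
rewrite mulf_neq0 ?cexp_i_neq0//; apply/eqP => -[] /eqP.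
by rewrite gt_eqF.
Qed.

Lemma onem_circ_neq0 th : 1 - circ th != 0.
Proof.
rewrite subr_eq0 eq_sym; apply/eqP => -[] .
rewrite expR0 !mul1r !mul0r subr0 addr0 => h1 h2.
have := cos2Dsin2 th; have : (r * cos th) ^+ 2 + (r * sin th) ^+ 2 = 1.
  by rewrite h1 h2 expr0n expr1n addr0.
rewrite !exprMn -mulrDr => + h; rewrite h mulr1 => r2.
have : r ^+ 2 < 1 by rewrite exprn_ilt1// ltW.
by rewrite r2 ltxx.
Qed.

Lemma ccont_circ : ccont circ.
Proof.
apply: ccontM; first exact: ccont_cst.
apply: ccont_cexp; split=> x /=; first exact: cst_continuous.
exact: cvg_id.
Qed.

Lemma ccont_eps_circ : ccont (fun th => epsilon (circ th)).
Proof.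
apply: ccontD; last exact: ccont_cst.
by apply: ccontV; [exact: circ_neq0|exact: ccont_circ].
Qed.

Lemma circXz th (m : int) :
  circ th ^ m = (r ^ m)%:C%C * cexp (Complex 0 (m%:~R * th)).
Proof.
rewrite /circ exprzMl ?unitfE ?cexp_i_neq0//; last first.
  by apply/eqP => -[] /eqP; rewrite gt_eqF.
by rewrite cexp_iXz rmorphXz// unitfE gt_eqF.
Qed.

Lemma cabs_circXz th (m : int) : cabs (circ th ^ m) <= 2 * r ^ m.
Proof.
have cR : cabs (r ^ m)%:C%C = r ^ m.
  by rewrite /cabs /= normr0 addr0 gtr0_norm// exprz_gt0.
rewrite circXz (le_trans (cabsM _ _))// cR mulrC ler_wpM2r ?exprz_ge0 ?(ltW r0)//.
by rewrite (le_trans (cabs_cexp _))//= expR0 mulr1.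
Qed.

Lemma oint_sum (I : Type) (s : seq I) (c : I -> C) (f : I -> C -> C) :
  (forall i, ccont (fun th => f i (circ th))) ->
  oint r (fun z => \sum_(i <- s) c i * f i z) = \sum_(i <- s) c i * oint r (f i).
Proof.
move=> cf; have cz : ccont (fun th => 'i%C * circ th).
  by apply: ccontM; [exact: ccont_cst|exact: ccont_circ].
rewrite /oint; transitivity (Cintegral 0 (2 * pi) (fun th => \sum_(i <- s)
   c i * (f i (circ th) * ('i%C * circ th)))).
  apply: eq_Cintegral => th; rewrite -/(circ th) mulr_suml.
  by apply: eq_bigr => i _; rewrite -mulrA.
rewrite Cintegral_sum => [|i]; last first.
  by apply: ccontM; [exact: ccont_cst|exact: ccontM].
by apply: eq_bigr => i _; rewrite CintegralZ//; exact: ccontM.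
Qed.

Lemma eq_oint (f g : C -> C) : (forall th, f (circ th) = g (circ th)) ->
  oint r f = oint r g.
Proof.
by move=> fg; apply: eq_Cintegral => th; congr (_ * _); exact: fg.
Qed.

Definition two_i_pi : C := 2 * (pi : R)%:C%C * 'i%C.

Lemma two_i_pi_neq0 : two_i_pi != 0.
Proof.
rewrite !mulf_neq0//.
- by apply/eqP => -[] /eqP; rewrite gt_eqF// pi_gt0.
- by apply/eqP => -[] /eqP; rewrite oner_eq0.
Qed.

(** The family is closed under both operations in use: a factor 1 - z raises e, and the time
    derivative, a factor 1/z - 1, acts on n. *)
Definition integrand (n e : int) (t : R) (z : C) : C :=
  z ^ n * (1 - z) ^ e * cexp (epsilon z * t%:C%C).

Definition contour_coef (n e : int) (t : R) : C :=
  two_i_pi^-1 * oint r (integrand n e t).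

Lemma ccont_integrand n e t : ccont (fun th => integrand n e t (circ th)).
Proof.
apply: ccontM.
  apply: ccontM; apply: ccontXz.
  - exact: circ_neq0.
  - exact: ccont_circ.
  - exact: onem_circ_neq0.
  - by apply: ccontD; [exact: ccont_cst|apply: ccontN; exact: ccont_circ].
apply: ccont_cexp; apply: ccontM; [exact: ccont_eps_circ|exact: ccont_cst].
Qed.

Lemma contour_coef_lin (s : seq (C * (int * int))) n e t :
  (forall th, integrand n e t (circ th) =
     \sum_(k <- s) k.1 * integrand k.2.1 k.2.2 t (circ th)) ->
  contour_coef n e t = \sum_(k <- s) k.1 * contour_coef k.2.1 k.2.2 t.
Proof.
move=> h; transitivity (two_i_pi^-1 * oint r (fun z =>
    \sum_(k <- s) k.1 * integrand k.2.1 k.2.2 t z)).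
  by congr (_ * _); exact: eq_oint.
rewrite oint_sum; last by move=> k; exact: ccont_integrand.
by rewrite mulr_sumr; apply: eq_bigr => k _; rewrite mulrCA.
Qed.

Lemma contour_coef_rec n e t :
  contour_coef n (e + 1) t = contour_coef n e t - contour_coef (n + 1) e t.
Proof.
rewrite (@contour_coef_lin [:: (1, (n, e)); (- 1, (n + 1, e))]).
  by rewrite !big_cons big_nil /= addr0 mul1r mulN1r.
move=> th; rewrite !big_cons big_nil /= addr0 /integrand.
rewrite !expfzDr ?circ_neq0 ?onem_circ_neq0// !expr1z; ring.
Qed.

(** In the application n = x - 1 - y, so lowering n by one is one step of the particle at y to the
    right: this is the free backward equation of a single particle. *)
Lemma cderiv_contour_coef n e t :
  cderiv (contour_coef n e) t (contour_coef (n - 1) e t - contour_coef n e t).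
Proof.
pose G th := circ th ^ n * (1 - circ th) ^ e * ('i%C * circ th).
have cG : ccont G.
  apply: ccontM; last by apply: ccontM; [exact: ccont_cst|exact: ccont_circ].
  apply: ccontM; apply: ccontXz.
  - exact: circ_neq0.
  - exact: ccont_circ.
  - exact: onem_circ_neq0.
  - by apply: ccontD; [exact: ccont_cst|apply: ccontN; exact: ccont_circ].
have := cderivZ two_i_pi^-1 (cderiv_Cintegral 0 (2 * pi) t cG ccont_eps_circ).
congr (cderiv _ _ _).
  apply/funext => u; congr (_ * _); apply: eq_Cintegral => th.
  by rewrite -/(circ th) /G /integrand; ring.
rewrite -mulrBr; congr (_ * _).
have := @oint_sum _ [:: (1, n - 1); (-1, n)] fst (fun k z => integrand k.2 e t z).
rewrite !big_cons !big_nil /= !addr0 mul1r mulN1r => <-; last first.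
  by move=> k; exact: ccont_integrand.
apply: eq_Cintegral => th /=.
rewrite -/(circ th) !big_cons !big_nil /= addr0 /G /integrand /epsilon.
rewrite !expfzDr ?circ_neq0// -invr_expz expr1z.
by move: (circ_neq0 th) => ?; ring.
Qed.

(** On the circle the dependence on n is the factor r^n, and the rest is continuous on a compact
    interval. Large negative n give the growth rate for uniqueness, n tending to infinity gives the
    decay used at time 0. *)
Lemma contour_coef_bound (e : int) (T : R) : exists2 K : R, 0 <= K &
  forall n t, 0 <= t <= T -> cabs (contour_coef n e t) <= K * r ^ n.
Proof.
pose G th := (1 - circ th) ^ e * ('i%C * circ th).
have cG : ccont G.
  apply: ccontM; last by apply: ccontM; [exact: ccont_cst|exact: ccont_circ].
  apply: ccontXz; first exact: onem_circ_neq0.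
  by apply: ccontD; [exact: ccont_cst|apply: ccontN; exact: ccont_circ].
pose g th := cabs (G th) * expR (`|Re (epsilon (circ th))| * T).
have pi20 : 0 <= 2 * pi :> R by rewrite mulr_ge0 ?pi_ge0.
have cg : continuous g.
  move=> x.
  have c0 : {for x, continuous (fun x => `|Re (epsilon (circ x))|)}.
    by apply: (continuous_comp (ccont_eps_circ.1 x)); exact: norm_continuous.
  have c1 : {for x, continuous (fun x => `|Re (epsilon (circ x))| * T)}.
    have ck : {for x, continuous (fun _ : R => T)} by exact: cst_continuous.
    exact: continuousM c0 ck.
  have c2 : {for x, continuous (fun x => expR (`|Re (epsilon (circ x))| * T))}.
    by apply: (continuous_comp c1); exact: continuous_expR.
  have c3 : {for x, continuous (fun x => cabs (G x))}.
    exact: (ccont_cabs cG).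
  have := continuousM c3 c2; exact.
have [c _ cmax] := EVT_max pi20 (continuous_subspaceT cg).
have g0 : 0 <= g c by rewrite mulr_ge0 ?cabs_ge0 ?expR_ge0.
(* The factor 2 (2 pi) is from [cabs_Cintegral_le]; the two other factors 2 are from [cabs_circXz]
   and [cabs_cexp]. *)
exists (cabs two_i_pi^-1 * (2 * (2 * pi) * (2 * 2 * g c))).
  by rewrite !mulr_ge0 ?cabs_ge0 ?pi_ge0.
move=> n t /andP[t0 tT].
have -> : cabs two_i_pi^-1 * (2 * (2 * pi) * (2 * 2 * g c)) * r ^ n =
   cabs two_i_pi^-1 * (2 * (2 * pi) * (4 * g c * r ^ n)) by ring.
rewrite (le_trans (cabsM _ _))// ler_wpM2l ?cabs_ge0//.
apply: cabs_Cintegral_le => //.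
  apply: ccontM; first exact: ccont_integrand.
  by apply: ccontM; [exact: ccont_cst|exact: ccont_circ].
move=> th th02; rewrite -/(circ th).
rewrite [X in cabs X](_ : _ = circ th ^ n * (G th * cexp (epsilon (circ th) * t%:C%C)));
  last by rewrite /= -/(circ th) /integrand /G; ring.
apply: (le_trans (cabsM _ _)).
have -> : 4 * g c * r ^ n = (2 * r ^ n) * (2 * g c) by ring.
apply: ler_pM; rewrite ?cabs_ge0 ?cabs_circXz//.
apply: (le_trans (cabsM _ _)).
apply: (@le_trans _ _ (cabs (G th) * (2 * expR (`|Re (epsilon (circ th))| * T)))).
  rewrite ler_wpM2l ?cabs_ge0// (le_trans (cabs_cexp _))// ler_wpM2l// ler_expR.
  rewrite ReM /= mulr0 subr0 (le_trans (ler_norm _))// normrM ler_wpM2l//.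
  by rewrite ger0_norm.
rewrite mulrCA ler_wpM2l//.
by apply: cmax; rewrite in_itv/=.
Qed.

Lemma contour_coef0_exp0 n : contour_coef n 0 0 = (n == -1)%:R.
Proof.
rewrite /contour_coef /oint; transitivity (two_i_pi^-1 * Cintegral 0 (2 * pi) (fun th =>
   ('i%C * (r ^ (n + 1))%:C%C) * cexp (Complex 0 ((n + 1)%:~R * th)))).
  congr (_ * _); apply: eq_Cintegral => th; rewrite -/(circ th).
  rewrite -mulrA -circXz expfzDr ?circ_neq0// expr1z /integrand expr0z.
  rewrite (_ : cexp _ = 1); last by rewrite mulr0 cexp_i0.
  by ring.
rewrite CintegralZ; last first.
  apply: ccont_cexp; split=> x /=; first exact: cst_continuous.
  have ck : {for x, continuous (fun _ : R => (n + 1)%:~R : R)} by exact: cst_continuous.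
  exact: continuousM ck (@cvg_id _ _).
rewrite Cintegral_cexp_i addr_eq0.
case: eqVneq => [n1|_]; last by rewrite !mulr0.
rewrite n1 expr0z mulr1 mulrC.
have -> : 'i%C * (2 * pi)%:C%C = two_i_pi :> C.
  by rewrite /two_i_pi mulrC; congr (_ * _); apply: complex_ext => /=; ring.
by rewrite mulfV ?two_i_pi_neq0.
Qed.

(* For a negative exponent e the value is constant in n >= 0 by the recurrence,
   and it is O(r^n). *)
Lemma contour_coef0_ge0 (n e : int) : 0 <= n -> contour_coef n e 0 = 0.
Proof.
have base n' : 0 <= n' -> contour_coef n' 0 0 = 0.
  by move=> n0; rewrite contour_coef0_exp0; case: eqP => // h; move: n0; rewrite h.
have pos m : forall n, 0 <= n -> contour_coef n m%:Z 0 = 0.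
  elim: m => [//|m IH] k k0.
  by rewrite -addn1 PoszD contour_coef_rec !IH ?subrr// addr_ge0.
have neg m : forall n, 0 <= n -> contour_coef n (- m%:Z) 0 = 0.
  elim: m => [|m IH] k k0; first by rewrite oppr0 base.
  have step j : 0 <= j ->
      contour_coef j (- m.+1%:Z) 0 = contour_coef (j + 1) (- m.+1%:Z) 0.
    move=> j0; apply/eqP; rewrite -subr_eq0 -contour_coef_rec.
    rewrite (_ : _ + 1 = - m%:Z) ?IH//.
    by rewrite -addn1 PoszD; ring.
  have steps j : contour_coef k (- m.+1%:Z) 0 = contour_coef (k + j%:Z) (- m.+1%:Z) 0.
    elim: j => [|j ->]; first by rewrite addr0.
    by rewrite step ?addr_ge0// -addrA -PoszD addn1.
  have [K K0 bK] := contour_coef_bound (- m.+1%:Z) 0.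
  have bound j : cabs (contour_coef k (- m.+1%:Z) 0) <= K * r ^ k * r ^+ j.
    rewrite (steps j); have := bK (k + j%:Z) 0; rewrite lexx => /(_ isT).
    by rewrite expfzDr ?gt_eqF// mulrA.
  have le0 : cabs (contour_coef k (- m.+1%:Z) 0) <= 0.
    move: (cabs _) (K * r ^ k) bound => b M bound.
    have cv : M * r ^+ j @[j --> \oo] --> M * 0.
      by apply: cvgMr; apply: cvg_expr; rewrite ger0_norm ?ltW.
    have : b <= M * 0 by apply: (cvgr_to_ge cv); exact: nearW.
    by rewrite mulr0.
  have : cabs (contour_coef k (- m.+1%:Z) 0) == 0 by rewrite eq_le le0 cabs_ge0.
  rewrite /cabs paddr_eq0// !normr_eq0 => /andP[/eqP h1 /eqP h2].
  exact: complex_ext.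
by case: e => m; [exact: pos|rewrite NegzE; exact: neg].
Qed.

(** The highest power of z in z^n (1-z)^m is n + m < -1, so the residue at 0 vanishes. *)
Lemma contour_coef0_lt (m : nat) (n : int) : n < -1 - m%:Z -> contour_coef n m%:Z 0 = 0.
Proof.
elim: m n => [|m IH] n.
  by rewrite subr0 contour_coef0_exp0 => n1; rewrite lt_eqF.
move=> nm; rewrite -addn1 PoszD contour_coef_rec !IH ?subrr//.
  by move: nm; rewrite -addn1 PoszD; lia.
by move: nm; rewrite -addn1 PoszD; lia.
Qed.

(** This is the coefficient of z^-1 in z^n (1 + z + z^2 + ...), obtained by descending from n = -1
    with the recurrence. *)
Lemma contour_coef0_expN1 (n : int) : n <= -1 -> contour_coef n (-1) 0 = 1.
Proof.
have H m : contour_coef (-1 - m%:Z) (-1) 0 = 1.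
  elim: m => [|m IH].
    have := contour_coef_rec (-1) (-1) 0; rewrite !addNr contour_coef0_exp0 eqxx.
    by rewrite (contour_coef0_ge0 _ (lexx 0)) !subr0 => <-.
  have := contour_coef_rec (-1 - m.+1%:Z) (-1) 0; rewrite addNr contour_coef0_exp0.
  rewrite (_ : -1 - m.+1%:Z + 1 = -1 - m%:Z); last by rewrite -addn1 PoszD; ring.
  rewrite IH (_ : (_ == _) = false); last by apply/eqP; lia.
  by move/eqP; rewrite eq_sym subr_eq0 => /eqP.
move=> n1; rewrite (_ : n = -1 - Posz (absz (n + 1))) ?H//.
by move: n1; lia.
Qed.

End contour.

(* Conversion tests would otherwise unfold the integrals. *)
Opaque contour_coef.

(** * The determinantal solution *)

Section bethe.
Variable R : realType.
Local Notation C := R[i].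
Local Notation Re := (@complex.Re R).
Local Notation Im := (@complex.Im R).
Variable r : R.
Hypotheses (r0 : 0 < r) (r1 : r < 1).
Variables (N : nat) (x : int).

(* Row j is attached to particle j and column k to an integration variable; the
   exponents j.-1 (that is 0, 0, 1, 2, ...) make the determinant satisfy the
   boundary conditions of [bethe_det_eq0] and [bethe_det_shift_blocked]. *)
Definition bethe_mx (t : R) (Y : positions N) : 'M[C]_N :=
  \matrix_(j, k) contour_coef r (x - 1 - Y j) (j.-1%:Z - k%:Z) t.

Definition bethe_det (t : R) (Y : positions N) : C := \det (bethe_mx t Y).

(** No order is required: the result may put two particles on one site, which is where the boundary
    conditions are read off. *)
Definition shift (Y : positions N) (i : 'I_N) : positions N :=
  [ffun k => if k == i then Y k + 1 else Y k].

(** The product rule differentiates one row at a time, which moves one particle: the determinant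
    solves the free equation for arbitrary positions. *)
Lemma cderiv_bethe_det t Y :
  cderiv (bethe_det ^~ Y) t (\sum_(i < N) (bethe_det t (shift Y i) - bethe_det t Y)).
Proof.
have D (j k : 'I_N) : cderiv (fun t => bethe_mx t Y j k) t
    (contour_coef r (x - 1 - Y j - 1) (j.-1%:Z - k%:Z) t - bethe_mx t Y j k).
  by rewrite !mxE; under eq_fun do rewrite mxE; exact: cderiv_contour_coef.
have := cderiv_sum (index_enum _) (fun s : 'S_N => cderivZ ((-1) ^+ s)
  (cderiv_prod (fun j => D j (s j)))).
congr (cderiv _ _ _).
under eq_bigr do rewrite mulr_sumr.
rewrite exchange_big/=; apply: eq_bigr => i _.
rewrite /bethe_det /determinant -sumrB; apply: eq_bigr => s _.
rewrite -mulrBr; congr (_ * _).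
rewrite mulrBl; congr (_ - _); last by rewrite [RHS](bigD1 i).
have -> : x - 1 - Y i - 1 = x - 1 - shift Y i i by rewrite ffunE eqxx; ring.
rewrite [RHS](bigD1 i)//= mxE; congr (_ * _).
by apply: eq_bigr => j ji; rewrite !mxE ffunE (negbTE ji).
Qed.

(** Two equal rows. The truncated predecessor makes i and j the indices 0 and 1, whose exponents
    coincide; this is the killing condition. *)
Lemma bethe_det_eq0 t (Y : positions N) (i j : 'I_N) :
  i != j -> Y i = Y j -> i.-1 = j.-1 -> bethe_det t Y = 0.
Proof.
move=> ij Yij cij; apply: (determinant_alternate ij) => k.
by rewrite !mxE Yij cij.
Qed.

(** By [contour_coef_rec] row i of the shifted matrix is the sum of rows i and j of the original
    one, and adding row j to row i preserves the determinant. *)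
Lemma bethe_det_shift_blocked t (Y : positions N) (i j : 'I_N) :
  i != 0%N :> nat -> j = i.+1 :> nat -> Y j = Y i + 1 ->
  bethe_det t (shift Y i) = bethe_det t Y.
Proof.
move=> i0 ij Yij.
have ji : j != i by rewrite -val_eqE /= ij; apply/eqP; lia.
pose D : 'M[C]_N :=
  \matrix_(a, k) if a == i then bethe_mx t Y j k else bethe_mx t Y a k.
have D0 : \det D = 0.
  apply: (determinant_alternate ji) => k.
  by rewrite !mxE eqxx (negbTE ji).
rewrite /bethe_det (@determinant_multilinear _ _ _ (bethe_mx t Y) D i 1 1).
- by rewrite D0 mulr0 addr0 mul1r.
- apply/rowP => k; rewrite !mxE ffunE !eqxx !mul1r Yij ij.
  rewrite (_ : x - 1 - (Y i + 1) = x - 1 - Y i - 1); last by ring.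
  rewrite (_ : i.+1.-1%:Z - k%:Z = (i.-1%:Z - k%:Z) + 1); last by move: i0; lia.
  by rewrite contour_coef_rec// subrK addrC subrK.
- by apply/matrixP => a k; rewrite !mxE ffunE eq_sym (negbTE (neq_lift _ _)).
- by apply/matrixP => a k; rewrite !mxE ffunE eq_sym (negbTE (neq_lift _ _)).
Qed.

Lemma increasing_lt (Y : positions N) (i j : 'I_N) :
  increasing Y -> (i < j)%N -> Y i < Y j.
Proof. by move=> /forallP/(_ i)/forallP/(_ j)/implyP; apply. Qed.

Lemma increasing_ge (Y : positions N) (i j : 'I_N) :
  increasing Y -> (i <= j)%N -> Y i + (j - i)%N%:Z <= Y j.
Proof.
move=> incY; move dE : (j - i)%N => d; elim: d j dE => [|d IH] j dE ij.
  have -> : j = i by apply: val_inj => /=; lia.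
  by rewrite addr0.
have jN : (j.-1 < N)%N by have := ltn_ord j; lia.
have := @increasing_lt _ (Ordinal jN) j incY; rewrite /= => /(_ _) lt_j.
have := IH (Ordinal jN); rewrite /= => /(_ _ _) le_j.
have {}le_j : Y i + d%:Z <= Y (Ordinal jN) by apply: le_j; lia.
have {}lt_j : Y (Ordinal jN) < Y j by apply: lt_j; lia.
by move: le_j lt_j; rewrite -addn1 PoszD; lia.
Qed.

(* At time 0 the matrix is triangular. *)
Lemma bethe_det_init (hN : (0 < N)%N) (Y : positions N) : increasing Y ->
  bethe_det 0 Y = (Y (Ordinal hN) == x)%:R.
Proof.
move=> incY; pose o := Ordinal hN.
(* For y_0 < x the row of particle 0 has only exponents n >= 0 and vanishes. For y_0 >= x,
   increasing positions give y_j >= x + j; the entries with k < j vanish and the diagonal is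
   [y_0 = x], 1, ..., 1. *)
have [Yx|xY] := ltP (Y o) x.
  rewrite lt_eqF// /bethe_det (expand_det_row _ o) big1// => k _.
  rewrite mxE contour_coef0_ge0 ?mul0r//; move: Yx; rewrite -/o; lia.
have ge_Y (j : 'I_N) : Y o + j%:Z <= Y j.
  by have := increasing_ge incY (leq0n j : (o <= j)%N); rewrite subn0.
rewrite /bethe_det -det_tr det_trig; last first.
  apply/is_trig_mxP => k j kj; rewrite !mxE.
  have -> : j.-1%:Z - k%:Z = (j.-1 - k)%N%:Z by move: kj; lia.
  by rewrite contour_coef0_lt//; have := ge_Y j; move: kj xY; lia.
rewrite (bigD1 o)//= big1 ?mulr1.
  rewrite !mxE /= subr0 contour_coef0_exp0//; congr ((_ : bool)%:R).
  by apply/eqP/eqP; rewrite -/o; lia.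
move=> j j0; rewrite !mxE.
have {}j0 : (0 < j)%N by rewrite lt0n; apply: contraNneq j0 => ?; apply/eqP/val_inj.
rewrite (_ : j.-1%:Z - j%:Z = -1); last by move: j0; lia.
by rewrite contour_coef0_expN1//; have := ge_Y j; move: xY j0; lia.
Qed.

Lemma bethe_det_bound (T : R) : exists2 K : R, 0 <= K &
  forall t Y, 0 <= t <= T -> cabs (bethe_det t Y) <= K * \prod_(j < N) r ^ (- Y j).
Proof.
have /choice[K0 K0P] : forall e : int, exists K : R, 0 <= K /\
    forall n t, 0 <= t <= T -> cabs (contour_coef r n e t) <= K * r ^ n.
  by move=> e; have [K K0 bK] := contour_coef_bound r0 r1 e T; exists K.
pose M := \sum_(j < N) \sum_(k < N) K0 (j.-1%:Z - k%:Z).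
have K0_ge0 e : 0 <= K0 e by have [] := K0P e.
have M_ge (j k : 'I_N) : K0 (j.-1%:Z - k%:Z) <= M.
  rewrite /M (bigD1 j)//= (bigD1 k)//= -addrA lerDl addr_ge0//.
    exact: sumr_ge0.
  by apply: sumr_ge0 => i _; exact: sumr_ge0.
have M0 : 0 <= M by apply: sumr_ge0 => j _; exact: sumr_ge0.
have rx : 0 <= r ^ (x - 1) by rewrite exprz_ge0// ltW.
exists (#|{: 'S_N}|%:R * (M * r ^ (x - 1)) ^+ N).
  by rewrite mulr_ge0// exprn_ge0// mulr_ge0.
move=> t Y tT; rewrite /bethe_det /determinant (le_trans (cabs_sum _ _))//.
rewrite -mulrA mulr_natl -sumr_const; apply: ler_sum => s _.
rewrite cabs_sign (le_trans (cabs_prod _ _))//.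
rewrite -[X in _ ^+ X]card_ord -prodr_const -big_split/=.
apply: ler_prod => j _; rewrite cabs_ge0/= mxE.
have [_ /(_ (x - 1 - Y j) t tT)] := K0P (j.-1%:Z - (s j)%:Z).
move/le_trans; apply.
rewrite expfzDr ?gt_eqF// mulrA ler_wpM2r ?exprz_ge0 ?(ltW r0)//.
by rewrite ler_wpM2r.
Qed.

Definition bethe_sol (t : R) (s : state N) : C :=
  if spec s == word21 N then bethe_det t (pos s) else 0.

(** A swap places a 2 at an index j > i, hence at j >= 1, which 21...1 forbids. As this word is
    never re-entered, the extension of the determinant by 0 to other words still solves the
    equation. *)
Lemma spec_jump (s : state N) (i : 'I_N) :
  spec (jump s i) = word21 N -> spec s = word21 N.
Proof.
rewrite /spec /= /raw_jump; case: s => -[X w] /= incX.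
case: pickP => [j /eqP Xj|//] /=; case: ifP => //= /andP[/eqP wi /eqP wj] /ffunP.
move=> /(_ j); rewrite !ffunE tpermR wi; case: eqP => // j0.
have ji : (j <= i)%N by rewrite j0.
have := increasing_ge incX ji; rewrite Xj => /= h.
by exfalso; move: h; lia.
Qed.

(** A free jump is a shift. A blocked jump of i >= 1 falls under [bethe_det_shift_blocked]. A swap
    by particle 0 destroys the word, and there the shifted determinant has y_0 = y_1 and vanishes as
    well. *)
Lemma bethe_sol_jump t (s : state N) (i : 'I_N) : spec s = word21 N ->
  bethe_sol t (jump s i) = bethe_det t (shift (pos s) i).
Proof.
case: s => -[X w]; rewrite /bethe_sol /pos /spec /= => incX ->.
case: pickP => [j /eqP Xj|/= empty]; last by rewrite eqxx.
have ij : (i < j)%N.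
  rewrite ltnNge; apply/negP => ji.
  by have := increasing_ge incX ji; rewrite Xj /=; lia.
have jS : j = i.+1 :> nat.
  apply/eqP; rewrite eqn_leq ij andbT.
  by have := increasing_ge incX (ltnW ij); rewrite Xj /=; lia.
rewrite !ffunE /= [val j == 0%N](_ : _ = false); last by rewrite /= jS.
rewrite eqxx andbT.
have [i0|i0] := eqVneq (i : nat) 0%N; rewrite /=.
  rewrite ifF; last first.
    apply/eqP => h; have := congr1 (fun f : word N => f i) h.
    by rewrite !ffunE tpermL /= i0 jS.
  apply/esym/(@bethe_det_eq0 _ _ i j); first by rewrite -val_eqE/= jS; apply/eqP; lia.
    by rewrite !ffunE eqxx Xj ifF//; rewrite -val_eqE/= jS; apply/eqP; lia.
  by rewrite jS; move: i0 => /= ->.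
by rewrite eqxx (@bethe_det_shift_blocked _ _ _ j).
Qed.

Lemma cderiv_bethe_sol t (s : state N) :
  cderiv (bethe_sol ^~ s) t (\sum_(i < N) (bethe_sol t (jump s i) - bethe_sol t s)).
Proof.
have [ws|/eqP ws] := eqVneq (spec s) (word21 N).
  have := cderiv_bethe_det t (pos s); congr (cderiv _ _ _).
    by apply/funext => u; rewrite /bethe_sol ws eqxx.
  by apply: eq_bigr => i _; rewrite bethe_sol_jump// /bethe_sol ws eqxx.
rewrite big1 => [|i _].
  rewrite (_ : bethe_sol ^~ s = fun=> 0); first exact: cderiv_cst.
  by apply/funext => u; rewrite /bethe_sol; case: eqP.
rewrite /bethe_sol; case: eqP => [/spec_jump//|_]; case: eqP => //; by rewrite subr0.
Qed.

(* The determinant grows at most like the product of the r^(-y_j), which a jump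
   multiplies by at most r^-1. *)
Definition weight (s : state N) : R := \prod_(j < N) (r ^ (- pos s j) + 1).

(** The summand 1 in each factor lets the weight dominate the probability too, so that one weight
    serves for the difference of the two solutions. *)
Lemma weight_ge1 s : 1 <= weight s.
Proof.
rewrite /weight -[leLHS](_ : \prod_(j < N) 1 = 1); last by rewrite big1.
by apply: ler_prod => j _; rewrite ler01 lerDr exprz_ge0// ltW.
Qed.

Lemma weight_jump s i : weight (jump s i) <= r^-1 * weight s.
Proof.
have ri1 : 1 <= r^-1 by rewrite invf_ge1// ltW.
have w0 : 0 <= weight s by rewrite (le_trans ler01)// weight_ge1.
have [e|e] : pos (jump s i) = pos s \/ pos (jump s i) = shift (pos s) i.
  rewrite /pos /= /raw_jump; case: s {w0} => -[X w] /= _.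
  case: pickP => [j _|_] /=; last by right.
  by left; case: ifP.
  by rewrite /weight e ler_peMl.
rewrite /weight e (bigD1 i)//= [in leRHS](bigD1 i)//= mulrA.
rewrite (eq_bigr (fun j => r ^ (- pos s j) + 1)); last first.
  by move=> j ji; rewrite ffunE (negbTE ji).
rewrite ler_wpM2r//.
  by apply: prodr_ge0 => j _; rewrite addr_ge0 ?exprz_ge0// ltW.
rewrite ffunE eqxx opprD expfzDr ?gt_eqF// mulrDr mulr1 exprN1.
by rewrite mulrC lerD.
Qed.

Lemma bethe_sol_bound (T : R) : exists2 K : R, 0 <= K &
  forall t s, 0 <= t <= T -> cabs (bethe_sol t s) <= K * weight s.
Proof.
have [K K0 bK] := bethe_det_bound T; exists K => // t s tT.
have w0 : 0 <= weight s by rewrite (le_trans ler01)// weight_ge1.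
rewrite /bethe_sol; case: eqP => _; last by rewrite cabs0 mulr_ge0.
rewrite (le_trans (bK _ _ tT))// ler_wpM2l//.
by apply: ler_prod => j _; rewrite exprz_ge0 ?(ltW r0)//= lerDl.
Qed.

(** Uniqueness concerns real functions, so it is applied twice: to the probability minus the real
    part of the determinant, and to the imaginary part, which solves the same equation with initial
    value 0. *)
Lemma hitting_eq_bethe_sol (hN : (0 < N)%N) (p : R -> state N -> state N -> R) :
  transition_function (@tasep_rate R N) p ->
  forall t s, 0 <= t ->
  (hitting p [set s : state N | spec s = word21 N /\ pos s (Ordinal hN) = x] t s)%:C%C
  = bethe_sol t s.
Proof.
move=> tfp t s t0.
set E := [set s : state N | _]; pose v := hitting p E.
have [K K0 bK] := bethe_sol_bound t.
have tT : 0 <= t <= t by rewrite t0 lexx.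
have wt0 s' : 0 <= weight s' by rewrite (le_trans ler01)// weight_ge1.
have ri0 : 0 <= r^-1 by rewrite invr_ge0 ltW.
have init s' : bethe_sol 0 s' = (v 0 s')%:C%C.
  rewrite /v (hitting_at0 tfp) /bethe_sol; case: eqP => [ws|ws].
    rewrite (bethe_det_init hN) ?(valP s')//.
    have -> : (s' \in E) = (pos s' (Ordinal hN) == x).
      by apply/idP/eqP; [move/set_mem => []|move=> h; apply/mem_set].
    by case: eqP.
  by rewrite (_ : (s' \in E) = false)//; apply/negbTE/negP => /set_mem[].
have cRe s' : Re (bethe_sol u s') @[u --> 0^'+] --> Re (bethe_sol 0 s').
  apply: cvg_at_right_filter; apply: differentiable_continuous.
  by apply/derivable1_diffP; have [[]] := cderiv_bethe_sol 0 s'.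
have cIm s' : Im (bethe_sol u s') @[u --> 0^'+] --> Im (bethe_sol 0 s').
  apply: cvg_at_right_filter; apply: differentiable_continuous.
  by apply/derivable1_diffP; have [_ []] := cderiv_bethe_sol 0 s'.
have Re_sum (f : 'I_N -> C) : Re (\sum_(i < N) f i) = \sum_(i < N) Re (f i).
  by elim/big_ind2: _ => // ? ? ? ? <- <-; rewrite ReD.
have Im_sum (f : 'I_N -> C) : Im (\sum_(i < N) f i) = \sum_(i < N) Im (f i).
  by elim/big_ind2: _ => // ? ? ? ? <- <-; rewrite ImD.
have Re0 : v t s - Re (bethe_sol t s) = 0.
  apply: (@backward_unique R _ N (@jump N) weight r^-1 (1 + K) t
    (fun t s => v t s - Re (bethe_sol t s))) => //.
  - by rewrite addr_ge0.
  - exact: weight_jump.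
  - by move=> s'; rewrite init /= subrr.
  - by move=> s'; apply: cvgB => //; exact: (hitting_cvg0 tfp).
  - move=> u s' u0.
    have := is_deriveB (hitting_backward tfp E s' u0) (cderiv_bethe_sol u s').1.
    congr (is_derive _ _ _ _); rewrite Re_sum -sumrB; apply: eq_bigr => i _.
    by rewrite /v ReD ReN; ring.
  - move=> u s' ut; rewrite (le_trans (ler_normB _ _))// mulrDl mul1r lerD//.
      have u0 : 0 <= u by case/andP: ut.
      rewrite ger0_norm ?(hitting_ge0 tfp)//.
      by rewrite (le_trans (hitting_le1 tfp _ _ u0))// weight_ge1.
    by rewrite (le_trans _ (bK _ _ ut))// /cabs lerDl.
have Im0 : Im (bethe_sol t s) = 0.
  apply: (@backward_unique R _ N (@jump N) weight r^-1 K t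
    (fun t s => Im (bethe_sol t s))) => //.
  - exact: weight_jump.
  - by move=> s'; rewrite init.
  - move=> u s' u0; have := (cderiv_bethe_sol u s').2.
    congr (is_derive _ _ _ _); rewrite Im_sum; apply: eq_bigr => i _.
    by rewrite ImD ImN.
  - by move=> u s' ut; rewrite (le_trans _ (bK _ _ ut))// /cabs lerDr.
apply: complex_ext; rewrite ?Im0//=.
by apply/eqP; rewrite -subr_eq0; apply/eqP.
Qed.

End bethe.

(** * Marginals of Markov processes *)

Lemma probability_setI_full (R : realType) (d : measure_display)
    (T : measurableType d) (P : probability T R) (A B : set T) :
  measurable A -> measurable B -> P A = 1%E -> P (A `&` B) = P B.
Proof.
move=> mA mB PA.
have PC : P (~` A) = 0%E by rewrite probability_setC// PA subee.
have P0 : P (B `&` ~` A) = 0%E.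
  apply/eqP; rewrite eq_le measure_ge0 andbT -PC.
  apply: le_measure; rewrite ?inE//; last exact: measurableC.
  by apply: measurableI => //; exact: measurableC.
have BA : P B = (P (B `&` A) + P (B `&` ~` A))%E.
  rewrite -measureU//; first by rewrite -setIUr setUv setIT.
  - exact: measurableI.
  - by apply: measurableI => //; exact: measurableC.
  - by rewrite setIACA setICr setI0.
by rewrite BA P0 adde0 setIC.
Qed.

(** Countable additivity over the fibres of X above E, numbered by [pickle]; F n is empty when n
    codes no element of E. *)
Lemma probability_discrete (R : realType) (d : measure_display)
    (T : measurableType d) (P : probability T R) (S : countType) (X : T -> S)
    (E : set S) :
  (forall y, measurable [set om | X om = y]) ->
  P [set om | E (X om)] = (\esum_(y in E) P [set om | X om = y])%E.
Proof.
move=> mX.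
pose F n := if pickle_inv n is Some y then [set om | X om = y /\ E y] else set0.
have F_pickle y : F (pickle y) = [set om | X om = y /\ E y] by rewrite /F pickleK_inv.
have FE y : E y -> F (pickle y) = [set om | X om = y].
  by move=> Ey; rewrite F_pickle; apply/seteqP; split=> om /= => [[]|].
have mF n : measurable (F n).
  rewrite /F; case: pickle_inv => [y|//]; have [Ey|Ey] := pselect (E y).
    rewrite (_ : [set om | _] = [set om | X om = y])//.
    by apply/seteqP; split=> om /= => [[]|].
  rewrite (_ : [set om | _] = set0)//.
  by apply/seteqP; split=> om //= [].
have tF : trivIset setT F.
  move=> m n _ _ [om []]; rewrite /F.
  have := @pickle_invK S m; have := @pickle_invK S n.
  by case: pickle_inv => [y|//]; case: pickle_inv => [z|//] /= <- <- [<- _] [<- _].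
have -> : [set om | E (X om)] = \bigcup_n F n.
  apply/seteqP; split=> om /= => [Eom|[n _]].
    by exists (pickle (X om)) => //; rewrite FE.
  by rewrite /F; case: pickle_inv => // y /= [<-].
rewrite measure_bigcup//= nneseries_esum; last by move=> n _; exact: measure_ge0.
rewrite set_mem_set.
transitivity (\esum_(n in pickle @` E) P (F n))%E.
  rewrite [RHS]esum_mkcond; apply: eq_esum => n _.
  case: ifPn => // /negP nE.
  suff -> : F n = set0 by rewrite measure0.
  rewrite /F; have := @pickle_invK S n; case: pickle_inv => //= y yn.
  apply/seteqP; split=> om //= [_ Ey]; apply: nE.
  by apply/mem_set; exists y.
rewrite esum_image; last by move=> y z _ _; exact: (pcan_inj pickleK).
by apply: eq_esum => y Ey; rewrite FE.
Qed.

(** The Markov property is taken at s = 0 with empty past, where conditioning is on an event of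
    probability 1. *)
Lemma markov_marginal (R : realType) (S : countType) (q : S -> S -> R)
    (d : measure_display) (Omega : measurableType d) (P : probability Omega R)
    (Z : R -> Omega -> S) (x0 : S) (E : set S) :
  markov_process q P Z x0 ->
  exists2 p, transition_function q p &
    forall t, 0 <= t ->
      P [set om | E (Z t om)] = (\esum_(y in E) (p t x0 y)%:E)%E.
Proof.
move=> [mZ Z0 [p tfp mp]]; exists p => // t t0.
rewrite probability_discrete; last by move=> y; exact: mZ.
apply: eq_esum => y _.
have past0 (u : R * S) : u \in [::] -> 0 <= u.1 <= 0 by rewrite in_nil.
have /= := mp [::] 0 t x0 y (lexx 0) t0 past0; rewrite add0r.
rewrite (_ : [set om | Z 0 om = x0 /\ _] = [set om | Z 0 om = x0]); last first.
  by apply/seteqP; split=> om /= => [[]|].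
by rewrite Z0 mul1e probability_setI_full//; exact: mZ.
Qed.

(** * Iterated contour integrals *)

Section iterated.
Variable R : realType.
Local Notation C := R[i].
Variable r : R.

(** Agreement is required only on the circle, where z and 1 - z are invertible. *)
Lemma eq_iter_oint (n : nat) (F G : n.-tuple C -> C) :
  (forall v : n.-tuple C, (forall i, exists th, tnth v i = circ r th) -> F v = G v) ->
  iter_oint r n F = iter_oint r n G.
Proof.
elim: n F G => [|n IH] F G FG /=; first by apply: FG => -[].
apply: eq_oint => th; apply: IH => v hv; apply: FG => i.
case: (unliftP ord0 i) => [j ->|->].
  by rewrite tnthS; exact: hv.
by exists th.
Qed.

(** For finite sums of products of one-variable functions the iterated integral factors by
    linearity, one variable at a time. *)
Lemma iter_oint_sum_prod (n : nat) (I : Type) (s : seq I) (c : I -> C)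
    (f : I -> 'I_n -> C -> C) :
  (forall k i, ccont (fun th => f k i (circ r th))) ->
  iter_oint r n (fun v => \sum_(k <- s) c k * \prod_(i < n) f k i (tnth v i)) =
  \sum_(k <- s) c k * \prod_(i < n) oint r (f k i).
Proof.
elim: n c f => [|n IH] c f cf /=.
  by apply: eq_bigr => k _; rewrite !big_ord0.
transitivity (oint r (fun z => \sum_(k <- s)
    (c k * \prod_(i < n) oint r (f k (lift ord0 i))) * f k ord0 z)).
  apply: eq_oint => th.
  transitivity (iter_oint r n (fun v => \sum_(k <- s)
     (c k * f k ord0 (circ r th)) * \prod_(i < n) f k (lift ord0 i) (tnth v i))).
    apply: eq_iter_oint => v _; apply: eq_bigr => k _.
    rewrite big_ord_recl mulrA; congr (_ * _); apply: eq_bigr => i _.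
    by rewrite tnthS.
  rewrite (IH (fun k => c k * f k ord0 (circ r th)) (fun k i => f k (lift ord0 i)));
    last by move=> k i; exact: cf.
  by apply: eq_bigr => k _; rewrite mulrAC.
rewrite oint_sum//; apply: eq_bigr => k _.
by rewrite big_ord_recl mulrAC mulrA.
Qed.

Lemma andreief (N : nat) (c : C) (phi psi : 'I_N -> C -> C) :
  (forall k j, ccont (fun th => phi k (circ r th) * psi j (circ r th))) ->
  iter_oint r N (fun v => c * (\det (\matrix_(k, i) phi k (tnth v i))
                             * \det (\matrix_(j, i) psi j (tnth v i)))) =
  c * (N`!%:R * \det (\matrix_(j < N, k < N) oint r (fun z => phi k z * psi j z))).
Proof.
move=> cpp.
transitivity (iter_oint r N (fun v => \sum_(st : 'S_N * 'S_N)
   (c * ((-1) ^+ st.1 * (-1) ^+ st.2))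
    * \prod_(i < N) (phi (st.1 i) (tnth v i) * psi (st.2 i) (tnth v i)))).
  apply: eq_iter_oint => v _.
  rewrite -det_tr -[X in _ * (_ * X)]det_tr /determinant big_distrlr/=.
  rewrite pair_big/= mulr_sumr.
  apply: eq_bigr => -[s t] _ /=; rewrite mulrACA -[RHS]mulrA; congr (_ * (_ * _)).
  by rewrite -big_split/=; apply: eq_bigr => i _; rewrite !mxE.
rewrite (@iter_oint_sum_prod N _ _
  (fun st : 'S_N * 'S_N => c * ((-1) ^+ st.1 * (-1) ^+ st.2))
  (fun st i z => phi (st.1 i) z * psi (st.2 i) z)); last by move=> st i; exact: cpp.
set M := \matrix_(j, k) _.
under eq_bigr do rewrite -mulrA.
rewrite -mulr_sumr; congr (_ * _).
rewrite -(pair_big xpredT xpredT (fun s t : 'S_N => (-1) ^+ s * (-1) ^+ t *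
   \prod_(i < N) oint r (fun z => phi (s i) z * psi (t i) z)))/=.
rewrite exchange_big/= (eq_bigr (fun=> \det M)); last first.
  (* The integral depends only on the permutation of one determinant relative to the other: for each
     t the sum over s is det M, whence the factor N!. *)
  move=> t _; rewrite (reindex_inj (mulgI t))/=; apply: eq_bigr => s _.
  rewrite odd_permM signr_addb [X in X * _](_ : _ = (-1) ^+ s); last first.
    by rewrite mulrAC -signr_addb addbb expr0 mul1r.
  congr (_ * _).
  rewrite [RHS](reindex_perm t)/=; apply: eq_bigr => i _.
  by rewrite mxE permM.
by rewrite sumr_const card_Sn mulr_natl.
Qed.

End iterated.

(** * The determinant at the special initial positions *)

Section contour_formula.
Variable R : realType.
Local Notation C := R[i].
Variable r : R.
Hypotheses (r0 : 0 < r) (r1 : r < 1).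

Lemma contour_formula_eq_bethe_det (N l : nat) (x : int) (t : R) : (0 < N)%N ->
  (-1) ^+ (N * N.-1)./2 / (N`!)%:R * (two_i_pi R)^-1 ^+ N
    * iter_oint r N (fun xi : N.-tuple C =>
        complete_sym l xi
        * (\prod_(i < N) \prod_(j < N | (i < j)%N)
             (tnth xi j - tnth xi i) ^+ 2)
        * (\prod_(i < N) ((tnth xi i - 1) ^+ N.-1)^-1)
        * (\prod_(i < N) (tnth xi i ^ (x - N%:Z - l%:Z - 1)
                          * cexp (epsilon (tnth xi i) * t%:C%C))))
  = bethe_det r x t (Y0 N l).
Proof.
move=> N0.
pose y (j : 'I_N) := if j == 0%N :> nat then 1%N else (j.+1 + l)%N.
have Y0E j : Y0 N l j = (y j)%:Z by rewrite ffunE /y /=; case: ifP.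
(* The integrand of entry (j, k) is split into phi_k psi_j: phi takes the factor depending on k, psi
   the one depending on j, and the common factor [om] goes with phi. *)
pose om (z : C) := z ^ (x - 1) * cexp (epsilon z * t%:C%C).
pose phi (k : 'I_N) (z : C) := (1 - z)^-1 ^+ k * om z.
pose psi (j : 'I_N) (z : C) := z ^- y j * (1 - z) ^+ j.-1.
have phi_psi j k th : phi k (circ r th) * psi j (circ r th) =
    integrand (x - 1 - Y0 N l j) (j.-1%:Z - k%:Z) t (circ r th).
  rewrite /integrand /phi /psi /om Y0E.
  rewrite (@expfzDr _ _ (x - 1) (- (y j)%:Z) (circ_neq0 r0 th)).
  rewrite (@expfzDr _ _ j.-1%:Z (- k%:Z) (onem_circ_neq0 r0 r1 th)).
  by rewrite exprVn !exprnN [_ ^+ j.-1]exprnP; ring.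
have cpp k j : ccont (fun th => phi k (circ r th) * psi j (circ r th)).
  by under eq_fun do rewrite phi_psi; exact: ccont_integrand.
pose sgn : C := (-1) ^+ (N * N.-1)./2.
have sgn2 : sgn * sgn = 1 by rewrite -expr2 sqrr_sign.
rewrite (@eq_iter_oint _ _ _ _ (fun v => sgn * (
   \det (\matrix_(k < N, i < N) phi k (tnth v i))
   * \det (\matrix_(j < N, i < N) psi j (tnth v i))))); last first.
  move=> v hv.
  have v0 i : tnth v i != 0 by have [th ->] := hv i; exact: circ_neq0.
  have v1 i : 1 - tnth v i != 0 by have [th ->] := hv i; exact: onem_circ_neq0.
  have -> : \matrix_(k < N, i < N) phi k (tnth v i) =
      (\matrix_(k < N, i < N) (1 - tnth v i)^-1 ^+ k)
      *m diag_mx (\row_i om (tnth v i)).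
    by apply/matrixP => k i; rewrite mul_mx_diag !mxE.
  rewrite det_mulmx det_diag det_powers_inv_onem// det_columns_eq_hsum// -/sgn.
  have -> : complete_sym l v = hsum l (tnth v) by [].
  have -> : \prod_(i < N) \prod_(j < N | (i < j)%N) (tnth v j - tnth v i) ^+ 2 =
      (\prod_(i < N) \prod_(j < N | (i < j)%N) (tnth v j - tnth v i)) ^+ 2.
    by rewrite -prodrXl; apply: eq_bigr => i _; rewrite -prodrXl.
  have -> : \prod_(i < N) ((tnth v i - 1) ^+ N.-1)^-1 =
      \prod_(i < N) (1 - tnth v i) ^- N.-1.
    (* Replacing 1 - xi by xi - 1 in all N factors of exponent N - 1 costs (-1)^(N(N-1)) = 1. *)
    have even_N : ~~ odd (N * N.-1).
      by rewrite oddM; case: (N) N0 => //= n _; rewrite andNb.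
    rewrite !prodfV !prodrXl; congr (_^-1).
    have -> : \prod_(i < N) (1 - tnth v i) = (-1) ^+ N * \prod_(i < N) (tnth v i - 1).
      rewrite -[N in (-1) ^+ N]card_ord -prodr_const -big_split/=.
      by apply: eq_bigr => i _; rewrite mulN1r opprB.
    by rewrite exprMn -exprM -signr_odd (negbTE even_N) mul1r.
  have -> : \prod_(i < N) (tnth v i ^ (x - N%:Z - l%:Z - 1)
                           * cexp (epsilon (tnth v i) * t%:C%C)) =
      (\prod_(i < N) om (tnth v i)) * \prod_(i < N) tnth v i ^- (N + l).
    rewrite -big_split/=; apply: eq_bigr => i _; rewrite /om mulrAC; congr (_ * _).
    rewrite exprnN -expfzDr//; congr (_ ^ _); rewrite PoszD; ring.
  have -> : \prod_(i < N) (\row_i om (tnth v i)) 0 i = \prod_(i < N) om (tnth v i).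
    by apply: eq_bigr => i _; rewrite mxE.
  rewrite -[LHS]mul1r -{1}sgn2; ring.
rewrite andreief//; set M := \matrix_(j, k) _.
have f0 : N`!%:R != 0 :> C by rewrite pnatr_eq0 -lt0n fact_gt0.
transitivity (\det ((two_i_pi R)^-1 *: M)).
  rewrite detZ -/sgn.
  move: sgn2 f0; move: (sgn) (N`!%:R) ((two_i_pi R)^-1 ^+ N) (\det M) => s f w D s2 f0.
  rewrite (_ : s / f * w * (s * (f * D)) = (s * s) * (f / f) * (w * D)).
    by rewrite s2 divff// !mul1r.
  by ring.
congr (\det _); apply/matrixP => j k; rewrite !mxE; congr (_ * _).
by apply: eq_oint => th; exact: phi_psi.
Qed.

End contour_formula.

Theorem theorem1p4 (R : realType) (N : nat) (hN : (0 < N)%N) (l : nat)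
    (x : int) (t : R) (ht : 0 <= t) (r : R) (hr0 : 0 < r) (hr1 : r < 1)
    (d : measure_display) (Omega : measurableType d) (P : probability Omega R)
    (Z : R -> Omega -> state N) (hZ : is_tasep P Z (init_state N l)) :
  ((fine (P [set om | spec (Z t om) = word21 N /\
                      pos (Z t om) (Ordinal hN) = x]))%:C)%C
  = (-1) ^+ (N * N.-1)./2 / (N`!)%:R
    * (2 * (pi : R)%:C%C * 'i%C)^-1 ^+ N
    * iter_oint r N (fun xi : N.-tuple R[i] =>
        complete_sym l xi
        * (\prod_(i < N) \prod_(j < N | (i < j)%N)
             (tnth xi j - tnth xi i) ^+ 2)
        * (\prod_(i < N) ((tnth xi i - 1) ^+ N.-1)^-1)
        * (\prod_(i < N) (tnth xi i ^ (x - N%:Z - l%:Z - 1)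
                          * cexp (epsilon (tnth xi i) * t%:C%C)))).
Proof.
rewrite (contour_formula_eq_bethe_det hr0 hr1 l x t hN).
have [p tfp marg] := markov_marginal
  [set s : state N | spec s = word21 N /\ pos s (Ordinal hN) = x] hZ.
rewrite (marg t ht) (esum_hitting tfp)//=.
by rewrite (hitting_eq_bethe_sol hr0 hr1 x hN tfp)// /bethe_sol eqxx.
Qed.
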